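(* Let $K$ be a field of characteristic zero and let $\sigma\in S_n$ be an involution ($\sigma^2=\mathrm{id}$). For every $f\in X_\sigma$ the defining ideal $\mathcal{I}(\Omega(f))\subset S(\mathfrak{n})=K[\mathfrak{n}^*]$ of the coadjoint orbit $\Omega(f)$ is generated by the polynomials $Q_{i,t}$, where $\varepsilon_t-\varepsilon_i\in\mathcal{M}$, together with the polynomials $D_m-D_m(f)$, where $1\le m\le s$.
   Context: $N=\mathrm{UT}(n,K)$ is the group of lower triangular $n\times n$ matrices over $K$ with ones on the diagonal, and $\mathfrak{n}=\mathfrak{ut}(n,K)$ is its Lie algebra of strictly lower triangular matrices, with standard basis $y_{ij}$ ($1\le j<i\le n$, the matrix unit with $1$ in row $i$, column $j$). The symmetric algebra $S(\mathfrak{n})$ is identified with the algebra $K[\mathfrak{n}^*]$ of polynomial functions on $\mathfrak{n}^*$ (so $y_{ij}$ is the function $f\mapsto f(y_{ij})$). $N$ acts on $\mathfrak{n}^*$ by $(\mathrm{Ad}^*_g f)(x)=f(\mathrm{Ad}_g^{-1}x)$, $\mathrm{Ad}_gx=gxg^{-1}$; $\Omega(f)$ is the orbit of $f$, and its defining ideal $\mathcal{I}(\Omega(f))$ consists of all polynomials in $K[\mathfrak{n}^*]$ vanishing on $\Omega(f)$. $\Delta^+=\{\varepsilon_j-\varepsilon_i : 1\le j<i\le n\}$ is the set of positive roots of $\mathfrak{gl}(n,K)$; for $\xi=\varepsilon_j-\varepsilon_i\in\Delta^+$ put $j(\xi)=j$, $i(\xi)=i$, $y_\xi=y_{ij}$,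 $r_\xi=(j,i)\in S_n$. $S_n$ acts on roots by $w(\varepsilon_j-\varepsilon_i)=\varepsilon_{w(j)}-\varepsilon_{w(i)}$; $\gamma>0$ means that the root $\gamma$ is positive. Write uniquely $\sigma=r_1\cdots r_s$ as a product of commuting reflections $r_m=r_{\xi_m}$, $\xi_m\in\Delta^+$, with $j(\xi_1)<\dots<j(\xi_s)$, and put $\mathcal{S}=\{\xi_1,\dots,\xi_s\}$. $X_\sigma\subset\mathfrak{n}^*$ is the set of all $f$ with $f(y_{\xi_m})\ne0$ for $1\le m\le s$ and $f(y_\gamma)=0$ for all $\gamma\in\Delta^+\setminus\mathcal{S}$. For $1\le t\le n-1$ let $\sigma_t=\prod_{j(\xi_m)\le t}r_m$, and $\sigma_0=\mathrm{id}$. Put $\mathcal{M}=\{\gamma\in\Delta^+ : \sigma_t(\gamma)>0,\ t=j(\gamma)\}$. Let $\Phi$ be the $n\times n$ matrix over $S(\mathfrak{n})$ with entry $y_{ij}$ at $(i,j)$ for $i>j$ and $0$ elsewhere, and $\Phi(\tau)=\tau\Phi+E$, $E$ the identity matrix, $\tau$ an indeterminate. For $1\le k,t\le n$ let $J'(k,t)=\{1\le j<t : \sigma(j)>k\}$, $I'(k,t)=\sigma J'(k,t)$, $J(k,t)=J'(k,t)\sqcup\{t\}$, $I(k,t)=I'(k,t)\sqcup\{k\}$. Let $D_{k,t}$ (resp. $D_{k,t}(\tau)$) be the minor of $\Phi$ (resp. $\Phi(\tau)$) with columns $J(k,t)$ and rows $I(k,t)$, both in increasing order. Decompose $D_{k,t}(\tau)=\tau^m(P_{k,t,0}+P_{k,t,1}\tau+P_{k,t,2}\tau^2+\cdots)$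 with $P_{k,t,a}\in S(\mathfrak{n})$ and $P_{k,t,0}\neq0$. Let $i>t$ and $\eta=\varepsilon_t-\varepsilon_i\in\mathcal{M}$. Say $\eta$ has type 0 if there is no $\xi\in\mathcal{S}$ with $j(\xi)\le t-1$ and $i(\xi)=i$; otherwise $\eta$ has type 1. Put $k=\sigma_{t-1}(i)$ and define $Q_{i,t}=P_{k,t,0}$ if $\eta$ has type 0, and $Q_{i,t}=P_{k,t,1}$ if $\eta$ has type 1. For $1\le m\le s$ put $D_m=D_{i(\xi_m),j(\xi_m)}$; $D_m(f)$ is its value at $f$. *)

(* Defs.v *)
From HB Require Import structures.
From mathcomp Require Import all_boot all_order all_algebra all_fingroup.
From mathcomp Require Export mpoly.

Set Implicit Arguments.
Unset Strict Implicit.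
Unset Printing Implicit Defensive.

Import GRing.Theory.
Local Open Scope ring_scope.

(* Indices run over 'I_n = {0, .., n-1}.  The root eps_a - eps_b is encoded as
   the ordered pair (a, b); it is positive when a < b. *)
Section Roots.
Variable n : nat.

Definition root_pos (r : 'I_n * 'I_n) : bool := (r.1 < r.2)%N.

(* eps_j - eps_i with j < i, i.e. jr < ir. *)
Definition posroot : predArgType := {r : 'I_n * 'I_n | root_pos r}.

Definition root_act (w : 'S_n) (r : 'I_n * 'I_n) : 'I_n * 'I_n :=
  (w r.1, w r.2).

Definition jr (g : posroot) : 'I_n := (val g).1.
Definition ir (g : posroot) : 'I_n := (val g).2.

Definition refl (g : posroot) : 'S_n := tperm (jr g) (ir g).

Definition refl_decomp (sigma : 'S_n) (xi : seq posroot) : Prop :=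
  [/\ sorted (fun a b => jr a < jr b)%N xi,
      {in xi &, forall a b, commute (refl a) (refl b)} &
      sigma = (\prod_(x <- xi) refl x)%g].

Lemma refl_decomp_exists (sigma : 'S_n) :
  (sigma * sigma = 1)%g -> exists xi, refl_decomp sigma xi.
Proof.
move=> s2; have sK a : sigma (sigma a) = a by rewrite -permM s2 perm1.
pose F (j : 'I_n) : option posroot := insub (j, sigma j).
have F_E j x : F j = Some x -> [/\ jr x = j, ir x = sigma j & (j < sigma j)%N].
  by rewrite /F; case: insubP => // u ju valu [<-]; rewrite /jr /ir valu.
exists (pmap F (enum 'I_n)); split.
- have -> : sorted (fun a b => jr a < jr b)%N (pmap F (enum 'I_n)) =
      sorted ltn (map (fun x => val (jr x)) (pmap F (enum 'I_n))).
    by rewrite sorted_map.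
  apply: (@subseq_sorted _ ltn ltn_trans _ (map val (enum 'I_n))); last first.
    by rewrite val_enum_ord iota_ltn_sorted.
  elim: (enum 'I_n) => //= j s IH; case Fj: (F j) => [x|] /=.
    by have [-> _ _] := F_E _ _ Fj; rewrite eqxx.
  exact: (subseq_trans IH (subseq_cons _ _)).
- have xiE x : x \in pmap F (enum 'I_n) ->
      ir x = sigma (jr x) /\ (jr x < sigma (jr x))%N.
    by rewrite mem_pmap => /mapP[j _ /esym /F_E[-> -> ]].
  move=> a b /xiE[ia ja] /xiE[ib jb].
  rewrite /commute; apply/commgP/conjg_fixP; rewrite /refl ia ib tpermJ.
  have [->|ne] := eqVneq (jr a) (jr b); first by rewrite tpermL tpermR tpermC.
  have ne1 : sigma (jr b) != jr a.
    by apply: contraTneq jb => eqb; rewrite -{1}[jr b]sK eqb -leqNgt ltnW.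
  have ne2 : jr b != sigma (jr a) by apply: contraNneq ne1 => ->; rewrite sK.
  have ne3 : sigma (jr b) != sigma (jr a) by rewrite (inj_eq perm_inj) eq_sym.
  by rewrite (tpermD _ ne1) ?(tpermD ne2 ne3) // eq_sym.
- have H s : uniq s -> forall a, (\prod_(x <- pmap F s) refl x)%g a =
    if [exists j : 'I_n, [&& j \in s, (j < sigma j)%N & (a == j) || (a == sigma j)]]
    then sigma a else a.
    elim: s => [_ a|j s IH /= /andP[js us] a].
      by rewrite big_nil perm1; case: existsP => // -[].
    case Fj: (F j) => [x|] /=; last first.
      rewrite IH //; congr (if _ then _ else _); apply: eq_existsb => b.
      rewrite inE; have [->|//] := eqVneq b j; rewrite (negPf js) /=.
      by move: Fj; rewrite /F; case: insubP => // /negPf; rewrite /root_pos /= => ->.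
    rewrite big_cons permM IH //; have [jx ix lj] := F_E _ _ Fj.
    rewrite /refl jx ix.
    have key b : b = j \/ b = sigma j -> [exists j0 : 'I_n,
       [&& j0 \in s, (j0 < sigma j0)%N & (b == j0) || (b == sigma j0)]] = false.
      move=> bj; apply/existsP => -[c /and3P[cs cl]].
      have ncj : c != j by apply: contraNneq js => <-.
      have nscj : sigma c != j.
        by apply: contraTneq lj => <-; rewrite sK -leqNgt ltnW.
      have nscj' : c != sigma j by apply: contraNneq nscj => ->; rewrite sK.
      case: bj => ->; first by rewrite !(eq_sym j) (negPf ncj) (negPf nscj).
      rewrite (inj_eq perm_inj) (eq_sym (sigma j)) (negPf nscj').
      by rewrite (eq_sym j) (negPf ncj).
    case: tpermP => [->|->|/eqP naj /eqP nasj].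
    + rewrite key; last by right.
      by case: existsP => // -[]; exists j; rewrite inE !eqxx lj.
    + rewrite key; last by left.
      by rewrite sK; case: existsP => // -[]; exists j; rewrite inE !eqxx lj orbT.
    congr (if _ then _ else _); apply: eq_existsb => b; rewrite inE.
    have [->|//] := eqVneq b j; by rewrite (negPf naj) (negPf nasj) !andbF.
  apply/permP => a; rewrite H ?enum_uniq //; case: existsP => // nex.
  have [lt|lt|/val_inj //] := ltngtP (sigma a) a; case: nex.
    by exists (sigma a); rewrite mem_enum sK lt eqxx orbT.
  by exists a; rewrite mem_enum lt eqxx.
Qed.

(* With 1-based column numbers this is sigma_m: the 0-based condition
   j < m reads j <= m. *)
Definition sigma_upto (xi : seq posroot) (m : nat) : 'S_n :=
  (\prod_(x <- xi | (jr x < m)%N) refl x)%g.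

Definition Mset (xi : seq posroot) : {set posroot} :=
  [set g : posroot | root_pos (root_act (sigma_upto xi (jr g).+1) (val g))].

End Roots.

Section Orbits.
Variables (K : fieldType) (n : nat).

Definition UT (g : 'M[K]_n) : bool :=
  is_trig_mx g && [forall i, g i i == 1].

Definition root_mx (g : posroot n) : 'M[K]_n := delta_mx (ir g) (jr g).

Definition ut : {vspace 'M[K]_n} := <<[seq root_mx g | g : posroot n]>>%VS.

Lemma memv_utP (A : 'M[K]_n) :
  reflect (forall i j : 'I_n, (i <= j)%N -> A i j = 0) (A \in ut).
Proof.
apply: (iffP idP) => [Aut i j le_ij | A0].
  rewrite (@coord_span _ _ _ (in_tuple [seq root_mx g | g : posroot n]) A Aut).
  rewrite summxE big1 // => k _; rewrite mxE.
  have /mapP[g _ ->] : (in_tuple [seq root_mx g | g : posroot n])`_k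
      \in [seq root_mx g | g : posroot n] by apply: mem_nth; case: k.
  rewrite mxE; case: eqP => [ig|_]; rewrite ?mulr0 //.
  case: eqP => [jg|_]; rewrite ?mulr0 //.
  by have := valP g; rewrite /root_pos -/(jr g) -/(ir g) -ig -jg ltnNge le_ij.
rewrite [A]matrix_sum_delta; apply: memv_suml => i _; apply: memv_suml => j _.
have [/A0 ->|lt_ji] := leqP i j; first by rewrite scale0r mem0v.
apply: memvZ; apply: memv_span.
by apply/mapP; exists (exist _ (j, i) lt_ji); rewrite ?mem_enum.
Qed.

Lemma UT_unit (g : 'M[K]_n) : UT g -> g \in unitmx.
Proof.
case/andP=> trg /forallP g1; rewrite unitmxE det_trig // big1 ?unitr1 // => i _.
exact/eqP.
Qed.

Lemma UT_inv (g : 'M[K]_n) : UT g -> UT (invmx g).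
Proof.
move=> UTg; have gV := mulmxV (UT_unit UTg).
case/andP: UTg => /is_trig_mxP trg /forallP g1.
have row_inv i j : (\sum_(k < n) g i k * invmx g k j) = (i == j)%:R.
  by move/matrixP/(_ i j): gV; rewrite !mxE.
have V0 m : forall i j : 'I_n, (i <= m)%N -> (i < j)%N -> invmx g i j = 0.
  elim: m => [|m IHm] i j le_im lt_ij; move: (row_inv i j).
    rewrite (bigD1 i) //= (eqP (g1 i)) mul1r big1 ?addr0 => [->|k ne_ki].
      by case: eqP lt_ij => // ->; rewrite ltnn.
    rewrite trg ?mul0r //; move: le_im; rewrite leqn0 => /eqP i0.
    by rewrite i0 lt0n -i0; apply: contraNneq ne_ki => /val_inj->.
  rewrite (bigD1 i) //= (eqP (g1 i)) mul1r big1 ?addr0 => [->|k ne_ki].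
    by case: eqP lt_ij => // ->; rewrite ltnn.
  have [lt_ik|] := ltnP i k; first by rewrite trg ?mul0r.
  rewrite leq_eqVlt => /orP[/eqP/val_inj ki|lt_ki]; first by rewrite ki eqxx in ne_ki.
  by rewrite IHm ?mulr0 ?(ltn_trans lt_ki) // -ltnS (leq_trans lt_ki).
have V0' (i j : 'I_n) : (i < j)%N -> invmx g i j = 0 by apply: (V0 i).
apply/andP; split; first exact/is_trig_mxP.
apply/forallP=> i; move: (row_inv i i); rewrite eqxx (bigD1 i) //= (eqP (g1 i)).
rewrite mul1r big1 ?addr0 => [->//|k ne_ki].
have [lt_ik|lt_ki|/val_inj ki] := ltngtP i k.
- by rewrite trg ?mul0r.
- by rewrite V0' ?mulr0.
- by rewrite ki eqxx in ne_ki.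
Qed.

Lemma conj_ut (g x : 'M[K]_n) : UT g -> x \in ut -> g *m x *m invmx g \in ut.
Proof.
move=> UTg /memv_utP x0; have /andP[/is_trig_mxP trV _] := UT_inv UTg.
have /andP[/is_trig_mxP trg _] := UTg.
apply/memv_utP => i j le_ij; rewrite mxE big1 // => k _.
have [lt_kj|le_jk] := ltnP k j; first by rewrite trV ?mulr0.
rewrite mxE big1 ?mul0r // => l _.
have [lt_il|le_li] := ltnP i l; first by rewrite trg ?mul0r.
by rewrite x0 ?mulr0 // (leq_trans le_li) // (leq_trans le_ij).
Qed.

(* Total in g; for UT g the projection vsproj is vacuous, see val_Ad. *)
Definition Ad (g : 'M[K]_n) : 'End(subvs_of ut) :=
  linfun (vsproj ut \o mulmxr (invmx g) \o mulmx g \o vsval).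

Lemma val_Ad (g : 'M[K]_n) (x : subvs_of ut) :
  UT g -> val (Ad g x) = g *m val x *m invmx g.
Proof. by move=> UTg; rewrite lfunE /= vsprojK ?conj_ut ?subvsP. Qed.

Definition ut_dual := 'Hom(subvs_of ut, K^o).

(* (Ad*_g f)(x) = f (Ad_g^-1 x). *)
Definition coAd (g : 'M[K]_n) (f : ut_dual) : ut_dual :=
  (f \o Ad (invmx g))%VF.

Definition coorbit (f : ut_dual) : ut_dual -> Prop :=
  fun h => exists2 g : 'M[K]_n, UT g & h = coAd g f.

(* S(ut) is the polynomial algebra on the basis (y_g) indexed by the positive
   roots; the variable number enum_rank g stands for y_g. *)
Definition Sut := {mpoly K[#|{: posroot n}|]}.

Definition yvar (g : posroot n) : Sut := 'X_(enum_rank g).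

Definition ybase (g : posroot n) : subvs_of ut := vsproj ut (root_mx g).

Lemma val_ybase g : val (ybase g) = root_mx g.
Proof. by rewrite /= vsprojK ?memv_span //; apply/mapP; exists g; rewrite ?mem_enum. Qed.

Definition evalS (p : Sut) (f : ut_dual) : K :=
  p.@[fun k => f (ybase (enum_val k))].

Definition vanishing_ideal (Z : ut_dual -> Prop) (p : Sut) : Prop :=
  forall h, Z h -> evalS p h = 0.

Definition Xsigma (xi : seq (posroot n)) (f : ut_dual) : Prop :=
  (forall g, g \in xi -> f (ybase g) != 0) /\
  (forall g, g \notin xi -> f (ybase g) = 0).

End Orbits.

Definition generated_ideal (R : comPzRingType) (G : R -> Prop) (p : R) : Prop :=
  exists2 s : seq (R * R),
    (forall cg, cg \in s -> G cg.2) & p = \sum_(cg <- s) cg.1 * cg.2.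

(* enum lists a set of ordinals in increasing order, so enum_val is the
   increasing enumeration of rows and columns. *)
Definition minor (R : comPzRingType) (n : nat) (A : 'M[R]_n) (I J : {set 'I_n})
    (eqIJ : #|I| = #|J|) : R :=
  \det (mxsub (fun a => enum_val (cast_ord (esym eqIJ) a)) enum_val A).

Section Minors.
Variables (K : fieldType) (n : nat).

Definition Phi : 'M[Sut K n]_n :=
  \matrix_(i, j) if insub (j, i) is Some g then yvar K g else 0.

Definition Phi_tau : 'M[{poly Sut K n}]_n :=
  'X *: map_mx polyC Phi + 1%:M.

Variable sigma : 'S_n.

Definition J' (k t : 'I_n) : {set 'I_n} :=
  [set j : 'I_n | (j < t)%N && (k < sigma j)%N].
Definition I' (k t : 'I_n) : {set 'I_n} := sigma @: J' k t.
Definition Jset (k t : 'I_n) : {set 'I_n} := t |: J' k t.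
Definition Iset (k t : 'I_n) : {set 'I_n} := k |: I' k t.

Lemma card_IJ k t : #|Iset k t| = #|Jset k t|.
Proof.
rewrite !cardsU1 card_imset; last exact: perm_inj.
have -> : k \notin I' k t.
  by apply/imsetP => -[j]; rewrite inE => /andP[_ /[swap] <-]; rewrite ltnn.
by rewrite inE ltnn.
Qed.

Definition Dmin (k t : 'I_n) : Sut K n := minor Phi (card_IJ k t).
Definition Dmin_tau (k t : 'I_n) : {poly Sut K n} :=
  minor Phi_tau (card_IJ k t).

(* P_{k,t,a}; m is the index of the first nonzero coefficient, and P = 0 when
   D_{k,t}(tau) = 0. *)
Definition Pcoef (k t : 'I_n) (a : nat) : Sut K n :=
  (Dmin_tau k t)`_(find (fun c => c != 0) (Dmin_tau k t) + a).

Variable xi : seq (posroot n).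

Definition type0 (g : posroot n) : bool :=
  ~~ has (fun x => (jr x < jr g)%N && (ir x == ir g)) xi.

Definition Qpol (g : posroot n) : Sut K n :=
  let k := sigma_upto xi (jr g) (ir g) in
  Pcoef k (jr g) (if type0 g then 0 else 1).

Definition orbit_gens (f : ut_dual K n) (q : Sut K n) : Prop :=
  (exists2 g, g \in Mset xi & q = Qpol g) \/
  (exists2 x, x \in xi &
     let D := Dmin (ir x) (jr x) in q = D - (evalS D f)%:MP).

End Minors.

(* Main.v *)
Require Import Defs.
From mathcomp Require Import all_boot all_algebra all_fingroup.
From mathcomp Require Import mpoly zify.

(** Identify f in n^* with the strictly lower triangular matrix of the values of
    the y_ij at f.  The coadjoint action of g becomes F |-> low(u F v), where
    u = g^-T, v = g^T are upper unitriangular and low is truncation to the strictly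
    lower part; for f in X_sigma, F is supported on the arcs j -> sigma(j), so that
    F^2 = 0.

    The generators vanish on an orbit point L = low(u F v): suitable combinations of
    the rows of v multiply W = u F v into rows of v, which yields explicit vectors
    killing the minors defining D_{k,t} and P_{k,t,0}; W^2 = 0 then kills P_{k,t,1}.

    Conversely, let Phi be the generic point.  Over S(n) one can choose u, v so that
    Psi = low(u F v) agrees with Phi at all roots outside M and the arcs.  Comparing
    the generators at Phi and at Psi column by column shows that Phi = Psi modulo the
    ideal they generate: in column t the generators are linear in delta = Phi_t - Psi_t,
    and the linear forms obtained are triangular in the entries of v delta.  Hence
    p(Phi) = p(Psi) modulo the ideal, and p(Psi) = 0 if p vanishes on the orbit, since
    K is infinite. *)

Set Implicit Arguments.
Unset Strict Implicit.
Unset Printing Implicit Defensive.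

Import GRing.Theory.
Local Open Scope ring_scope.

(** * Determinants of masked matrices *)

(** The only units of S(n) are the nonzero constants, so no rank argument over a field is available
    at the generic orbit point: everything that is inverted is a unitriangular block or one of the
    constants f(y_xi). The lemmas on orbit points are therefore stated over a commutative ring with
    units and produce explicit rows; each serves over K, at points of the orbit, or over S(n), at
    Psi, or both. Membership in the ideal also requires more than knowing where a linear form
    vanishes: the form must be exhibited as a multiple of the minor, which is why surjectivity of
    the remaining rows is proved next to every kernel row. Because u and v involve no division
    except by these constants, the entries of Psi are polynomials and can be substituted into p;
    neither irreducibility of the orbit nor radicality of the ideal of the generators enters. The
    comparison in column t is linear because the minors for (k, t) use no column after t, while the
    columns before t already agree modulo the ideal. *)

Section MaskedDeterminant.
Variable R : comNzRingType.

Lemma det_addM m q (B : 'M[R]_(m, q)) (C : 'M[R]_(q, m)) :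
  \det (1%:M + B *m C) = \det (1%:M + C *m B).
Proof.
have eqM : block_mx 1%:M (- B) 0 1%:M *m block_mx (1%:M + B *m C) 0 C 1%:M
    = block_mx 1%:M 0 C 1%:M *m block_mx 1%:M (- B) 0 (1%:M + C *m B) :> 'M_(m + q).
  rewrite !mulmx_block; congr block_mx;
    by rewrite ?(mul1mx, mulmx1, mul0mx, mulmx0, addr0, add0r, mulNmx, mulmxN)
      ?addrK // ?[1%:M + _]addrC ?addKr ?addrA ?addNr ?add0r.
by move/(congr1 determinant): eqM; rewrite !det_mulmx !det_ublock !det_lblock
  !det1 !(mul1r, mulr1).
Qed.

Lemma det_col_add n (A B C : 'M[R]_n) t :
    (forall i, A i t = B i t + C i t) ->
    (forall i j, j != t -> B i j = A i j) -> (forall i j, j != t -> C i j = A i j) ->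
  \det A = \det B + \det C.
Proof.
move=> ABC BA CA; rewrite -det_tr -(det_tr B) -(det_tr C).
rewrite (@determinant_multilinear _ _ A^T B^T C^T t 1 1) ?mul1r ?scale1r //.
- by apply/rowP=> i; rewrite !mxE ABC.
- by apply/matrixP=> i j; rewrite !mxE BA // eq_sym neq_lift.
- by apply/matrixP=> i j; rewrite !mxE CA // eq_sym neq_lift.
Qed.

(** Padding a principal block with the identity keeps the index type ['I_n], so that blocks for
    different [J] multiply and compare without casts between ordinals. *)
Definition mask n (J : {set 'I_n}) (A : 'M[R]_n) : 'M[R]_n :=
  \matrix_(i, j) if (i \in J) && (j \in J) then A i j else (i == j)%:R.

Lemma maskE n (J : {set 'I_n}) (A : 'M[R]_n) i j :
  mask J A i j = if (i \in J) && (j \in J) then A i j else (i == j)%:R.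
Proof. by rewrite mxE. Qed.

Lemma det_mask n (J : {set 'I_n}) (A : 'M[R]_n) :
  \det (mask J A) =
    \det (mxsub (enum_val : 'I_#|J| -> 'I_n) (enum_val : 'I_#|J| -> 'I_n) A).
Proof.
pose e : 'I_#|J| -> 'I_n := enum_val.
pose B : 'M[R]_(n, #|J|) := \matrix_(a, b) (a == e b)%:R.
pose AJ := mxsub e e A; rewrite -[mxsub _ _ _]/AJ.
have BB : B^T *m B = 1%:M.
  apply/matrixP=> b c; rewrite !mxE (bigD1 (e b)) //= !mxE eqxx mul1r big1.
    by rewrite addr0 (inj_eq enum_val_inj).
  by move=> a ne; rewrite !mxE (negPf ne) mul0r.
(* The columns of [B] are the basis vectors indexed by [J]; the masked matrix is thus a perturbation
   of the identity factoring through size [#|J|], where [det_addM] moves the determinant. *)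
have -> : mask J A = 1%:M + B *m ((AJ - 1%:M) *m B^T).
  have BE i (g : 'I_#|J| -> R) : i \in J ->
      exists2 b, e b = i & \sum_c B i c * g c = g b.
    move=> iJ; exists (enum_rank_in iJ i); first by rewrite /e enum_rankK_in.
    rewrite (bigD1 (enum_rank_in iJ i)) //= mxE /e enum_rankK_in // eqxx mul1r.
    rewrite big1 ?addr0 // => c ne; rewrite mxE; case: eqP => [eqi|_].
      by case/eqP: ne; apply: enum_val_inj; rewrite enum_rankK_in.
    by rewrite mul0r.
  have B0 i b : i \notin J -> B i b = 0.
    by move=> iJ; rewrite mxE; case: eqP iJ => // ->; rewrite enum_valP.
  apply/matrixP=> i j; rewrite [RHS]mxE [1%:M i j]mxE [(B *m _) i j]mxE mxE.
  have [iJ|iJ] /= := boolP (i \in J); last first.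
    by rewrite big1 ?addr0 // => b _; rewrite B0 ?mul0r.
  have [b <- ->] := BE i (fun c => ((AJ - 1%:M) *m B^T) c j) iJ.
  have [jJ|jJ] /= := boolP (j \in J); last first.
    rewrite [(_ *m _) b j]mxE big1 ?addr0 // => c _.
    by rewrite [B^T c j]mxE B0 ?mulr0.
  rewrite [(_ *m _) b j]mxE.
  rewrite (eq_bigr (fun c => B j c * (AJ - 1%:M) b c)); last first.
    by move=> c _; rewrite [B^T c j]mxE mulrC.
  have [c <- ->] := BE j (fun c => (AJ - 1%:M) b c) jJ.
  by rewrite !mxE /= (inj_eq enum_val_inj) addrC subrK.
by rewrite det_addM -mulmxA BB mulmx1 addrC subrK.
Qed.

(* The sign depends on I, J and theta only. *)
Lemma minor_mask n (I J : {set 'I_n}) (eqIJ : #|I| = #|J|) (theta : 'I_n -> 'I_n) :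
    {in J, forall j, theta j \in I} -> {in J &, injective theta} ->
  exists b : bool, forall A : 'M[R]_n,
    minor A eqIJ = (-1) ^+ b * \det (mask J (\matrix_(i, j) A (theta i) j)).
Proof.
move=> thI th_inj.
have thQ (b : 'I_#|J|) : theta (enum_val b) \in I by apply/thI/enum_valP.
pose p0 (b : 'I_#|J|) := cast_ord eqIJ (enum_rank_in (thQ b) (theta (enum_val b))).
have p0E b : enum_val (cast_ord (esym eqIJ) (p0 b)) = theta (enum_val b).
  by rewrite /p0 cast_ordK enum_rankK_in.
have p0_inj : injective p0.
  move=> b c eqp; apply: enum_val_inj; apply: th_inj; rewrite ?enum_valP //.
  by rewrite -!p0E eqp.
pose p := perm p0_inj; exists p => A; rewrite det_mask.
set B := mxsub _ _ (\matrix_(i, j) A (theta i) j).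
have -> : B = row_perm p (mxsub (fun a => enum_val (cast_ord (esym eqIJ) a)) enum_val A).
  by apply/matrixP=> a b; rewrite !mxE permE p0E.
by rewrite row_permE det_mulmx det_perm mulrA -signr_addb addbb mul1r.
Qed.
End MaskedDeterminant.

Section Pencil.
Variables (n : nat) (J C : {set 'I_n}) (theta : 'I_n -> 'I_n).

(** Here [theta] is to be a bijection from the columns [J] to the rows [I] that fixes [C = J :&: I].
    A row of [Phi_tau] indexed outside [J] meets the columns [J] in multiples of tau only; the
    pencil is what remains once a factor tau is taken out of each such row. *)
Definition pencil (R : comNzRingType) (L : 'M[R]_n) : 'M[{poly R}]_n :=
  mask J (\matrix_(i, j) if i \in C then (i == j)%:R + 'X * (L i j)%:P
                         else (L (theta i) j)%:P).

Lemma pencilE (R : comNzRingType) (L : 'M[R]_n) i j :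
  pencil L i j = if (i \in J) && (j \in J) then
      if i \in C then (i == j)%:R + 'X * (L i j)%:P else (L (theta i) j)%:P
    else (i == j)%:R.
Proof. by rewrite maskE mxE. Qed.

Lemma coef_det_pencil_map (R R' : comNzRingType) (eps : {rmorphism R -> R'})
    (L : 'M[R]_n) a :
  eps ((\det (pencil L))`_a) = (\det (pencil (map_mx eps L)))`_a.
Proof.
rewrite -coef_map -det_map_mx; congr ((polyseq (\det _))`_ _).
apply/matrixP=> i j; rewrite !mxE; case: ifP => _; last by rewrite rmorph_nat.
by case: ifP => _; rewrite ?rmorphD ?rmorphM /= ?rmorph_nat ?map_polyX map_polyC.
Qed.

Lemma det_pencil_coef0 (R : comNzRingType) (L : 'M[R]_n) :
  (\det (pencil L))`_0 =
  \det (mask J (\matrix_(i, j) if i \in C then (i == j)%:R else L (theta i) j)).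
Proof.
rewrite -[LHS]/(coefp 0 _) -det_map_mx; congr (\det _).
apply/matrixP=> i j; rewrite !mxE; case: ifP => _; last exact: rmorph_nat.
case: ifP => _; last by rewrite /= coefC.
by rewrite rmorphD rmorph_nat /= coefXM addr0.
Qed.
End Pencil.

(** * The coefficients P_{k,t,a} as coefficients of a pencil determinant *)

Section LeadingCoefficients.
Variables (K : fieldType) (n : nat) (sigma : 'S_n) (k t : 'I_n).
Let I := Iset sigma k t.
Let J := Jset sigma k t.
Variable theta : 'I_n -> 'I_n.
Hypothesis thI : {in J, forall j, theta j \in I}.
Hypothesis th_inj : {in J &, injective theta}.
Hypothesis th_id : {in J :&: I, forall j, theta j = j}.
Hypothesis th_gt : {in J :\: I, forall j : 'I_n, (j < theta j)%N}.

Lemma PhiE i j : Phi K n i j = if insub (j, i) is Some g then yvar K g else 0.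
Proof. by rewrite mxE. Qed.

Lemma Dmin_tau_pencil : exists b : bool, Dmin_tau K sigma k t =
  (-1) ^+ b * ('X ^+ #|J :\: I| * \det (pencil J (J :&: I) theta (Phi K n))).
Proof.
have [b minorE] := @minor_mask {poly Sut K n} n I J (card_IJ sigma k t) theta thI th_inj.
exists b; rewrite /Dmin_tau minorE; congr (_ * _).
have thNJ i : i \in J :\: I -> theta i \notin J.
  case/setDP=> iJ iNI; apply: contraNN iNI => thJ.
  have thIJ : theta i \in J :&: I by rewrite inE thJ thI.
  by rewrite -(th_inj _ _ (th_id thIJ)) ?thI.
pose d : 'rV[{poly Sut K n}]_n := \row_j if j \in J :\: I then 'X else 1.
have -> : 'X ^+ #|J :\: I| = \det (diag_mx d).
  rewrite det_diag (eq_bigr (fun j => if j \in J :\: I then 'X else 1)).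
    by rewrite -big_mkcond prodr_const.
  by move=> j _; rewrite mxE.
rewrite -det_mulmx mul_diag_mx; congr (\det _); apply/matrixP=> i j.
rewrite !mxE; case: ifP => [/andP[iJ jJ]|]; last first.
  case: ifP => [/setDP[iJ iI]|_ _]; last by rewrite mul1r.
  by rewrite iJ /= => jJ; case: eqP jJ iJ => [-> -> //|_]; rewrite mulr0.
rewrite in_setD in_setI iJ andbT /= -PhiE; have [iI|iI] := boolP (i \in I) => /=.
  by rewrite mul1r addrC -[X in _ = _ + 'X * X%:P]PhiE th_id ?in_setI ?iI ?iJ.
have -> : (theta i == j) = false.
  by apply/eqP=> thj; have := thNJ i; rewrite in_setD iJ iI thj jJ => /(_ isT).
by rewrite addr0.
Qed.

Lemma pencil_coef0_neq0 :
  (\det (pencil J (J :&: I) theta (Phi K n)))`_0 != 0.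
Proof.
rewrite det_pencil_coef0; apply/eqP => D0.
(* The point with coordinate 1 at [(theta j, j)] for [j] in [J :\: I] and 0 elsewhere. By [th_gt]
   these entries of [Phi] are variables, and the matrix specialises to the identity. *)
pose v (a : 'I_#|{: posroot n}|) : K :=
  ((jr (enum_val a) \in J :\: I) && (ir (enum_val a) == theta (jr (enum_val a))))%:R.
have /eqP := congr1 (meval v) D0; rewrite meval0 -det_map_mx.
set A := map_mx _ _; suff -> : A = 1%:M by rewrite det1 oner_eq0.
apply/matrixP=> i j; rewrite !mxE; case: ifP => [/andP[iJ jJ]|_]; last exact: rmorph_nat.
case: ifP => [_|iIJ]; first exact: rmorph_nat.
have iY : i \in J :\: I by rewrite in_setD iJ andbT; move: iIJ; rewrite in_setI iJ => /negbT.
case: insubP => [g _ valg|].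
  have [gj gi] : jr g = j /\ ir g = theta i by rewrite /jr /ir valg.
  rewrite /= /yvar mevalXU /v enum_rankK gj gi; congr (_%:R).
  have [<-|ne] := eqVneq i j; first by rewrite iY eqxx.
  by rewrite (inj_in_eq th_inj) // (negPf ne) andbF.
by rewrite /root_pos /= rmorph0; case: eqP => // <-; rewrite th_gt.
Qed.

(** Since the constant coefficient of the pencil determinant is nonzero, the exponent m of tau split
    off in the definition of P_{k,t,a} is exactly [#|J :\: I|]. *)
Lemma Pcoef_pencil : exists b : bool, forall a, Pcoef K sigma k t a =
  (-1) ^+ b * (\det (pencil J (J :&: I) theta (Phi K n)))`_a.
Proof.
have [b DE] := Dmin_tau_pencil; exists b => a.
set P := \det _ in DE *; have P0 : P`_0 != 0 := pencil_coef0_neq0.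
have cE c : (Dmin_tau K sigma k t)`_(#|J :\: I| + c) = (-1) ^+ b * P`_c.
  by rewrite DE !mulr_sign; case: (b); rewrite ?coefN coefXnM ltnNge leq_addr /= addKn.
rewrite /Pcoef -cE; congr (_`_ (_ + _)).
set s := polyseq _; set m := #|_|.
have sm : s`_m != 0.
  by rewrite -[m]addn0 cE mulf_neq0 // signr_eq0.
have ltm : (m < size s)%N.
  by rewrite ltnNge; apply: contraNN sm => le; rewrite nth_default.
have hass : has (fun c => c != 0) s by apply/(has_nthP 0); exists m.
apply/eqP; rewrite eqn_leq; apply/andP; split.
  by rewrite leqNgt; apply: contraNN sm => /(before_find 0) /negbFE.
rewrite leqNgt; apply: contraTN (nth_find 0 hass).
move: (find _ s) => i lt; by rewrite negbK /s DE mulr_sign; case: (b); rewrite ?coefN coefXnM lt ?oppr0.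
Qed.
End LeadingCoefficients.

(** * Unitriangular matrices *)

Section Unitriangular.
Variables (R : comUnitRingType) (n : nat).
Implicit Types (v : 'M[R]_n) (c : 'rV[R]_n).

Definition upper_unitri v := forall i j : 'I_n, (j <= i)%N -> v i j = (i == j)%:R.

Lemma det_upper_unitri v : upper_unitri v -> \det v = 1.
Proof.
move=> vU; rewrite -det_tr det_trig; last first.
  apply/is_trig_mxP=> i j lt; rewrite mxE vU; last exact: ltnW.
  by case: eqP lt => // ->; rewrite ltnn.
by apply: big1 => i _; rewrite mxE vU ?eqxx.
Qed.

Lemma upper_unitri_mask v (P : {set 'I_n}) : upper_unitri v -> upper_unitri (mask P v).
Proof. by move=> vU i j le; rewrite mxE; case: ifP => // _; apply: vU. Qed.

Lemma upper_unitri1 : upper_unitri (1%:M : 'M[R]_n).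
Proof. by move=> i j _; rewrite mxE. Qed.

Lemma upper_unitriM v1 v2 : upper_unitri v1 -> upper_unitri v2 ->
  upper_unitri (v1 *m v2).
Proof.
move=> U1 U2 i j le; rewrite mxE (bigD1 j) //= (U1 _ _ le) (U2 j j) // eqxx mulr1.
rewrite big1 ?addr0 // => p ne; have [lt|ge] := ltnP p i.
  by rewrite U1 ?(ltnW lt) //; case: eqP lt => [->|_]; rewrite ?ltnn ?mul0r.
by rewrite U2 ?(leq_trans le) // (negPf ne) mulr0.
Qed.

Lemma mulmx_upper_unitri_eq0 v c (m : nat) : upper_unitri v ->
    (forall p : 'I_n, (p < m)%N -> c 0 p = 0) ->
  forall x : 'I_n, (x < m)%N -> (c *m v) 0 x = 0.
Proof.
move=> vU c0 x ltx; rewrite mxE big1 // => p _.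
have [lt|ge] := ltnP p m; first by rewrite c0 ?mul0r.
rewrite vU; last by rewrite ltnW // (leq_trans ltx).
by case: eqP ge => [->|_ _]; rewrite ?mulr0 // leqNgt ltx.
Qed.

Lemma mulmx_upper_unitri_lead v c (m : 'I_n) : upper_unitri v ->
  (forall p : 'I_n, (p < m)%N -> c 0 p = 0) -> (c *m v) 0 m = c 0 m.
Proof.
move=> vU c0; rewrite mxE (bigD1 m) //= vU // eqxx mulr1 big1 ?addr0 // => p ne.
have [lt|ge] := ltnP p m; first by rewrite c0 ?mul0r.
by rewrite vU // (negPf ne) mulr0.
Qed.

Lemma mulmx_mask (J : {set 'I_n}) (g : 'rV[R]_n) (A : 'M[R]_n) j :
    (forall x, x \notin J -> g 0 x = 0) ->
  (g *m mask J A) 0 j = if j \in J then (g *m A) 0 j else 0.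
Proof.
move=> g0; rewrite mxE; case: ifP => jJ.
  rewrite mxE; apply: eq_bigr => i _; rewrite mxE jJ andbT.
  by case: ifP => // /negbT /g0->; rewrite !mul0r.
apply: big1 => i _; rewrite mxE jJ andbF; case: eqP => [->|_]; rewrite ?mulr0 //.
by rewrite g0 ?jJ ?mul0r.
Qed.

(** A principal block of a unitriangular matrix is unitriangular, hence invertible over any ring. *)
Lemma upper_unitri_solve v (P : {set 'I_n}) (h : 'I_n -> R) : upper_unitri v ->
  exists z : 'rV[R]_n, (forall x, x \notin P -> z 0 x = 0) /\
    {in P, forall p, (z *m v) 0 p = h p}.
Proof.
move=> vU; pose V := mask P v; have VU : upper_unitri V by apply: upper_unitri_mask.
have Vu : V \in unitmx by rewrite unitmxE det_upper_unitri // unitr1.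
pose h' : 'rV[R]_n := \row_p if p \in P then h p else 0.
pose z := h' *m invmx V; have zV : z *m V = h' by rewrite mulmxKV.
have zVE x : (z *m V) 0 x = if x \in P then h x else 0 by rewrite zV mxE.
have z0 x : x \notin P -> z 0 x = 0.
  move=> xP; have := zVE x; rewrite (negPf xP) mxE (bigD1 x) //= maskE (negPf xP).
  rewrite eqxx mulr1 big1 ?addr0 // => i ne.
  by rewrite maskE (negPf xP) andbF (negPf ne) mulr0.
exists z; split=> // p pP; have := zVE p; by rewrite mulmx_mask // pP.
Qed.

(* With G the matrix whose row t is w and whose other rows solve g H = e_j off
   column t, G H is the identity up to column t, so w H = det G * det H there. *)
Lemma det_dvd_of_rows (H : 'M[R]_n) (t : 'I_n) (w : 'rV[R]_n) :
    (forall r : 'I_n -> R, exists g : 'rV[R]_n,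
       forall j, j != t -> (g *m H) 0 j = r j) ->
    (forall j, j != t -> (w *m H) 0 j = 0) ->
  exists e : R, (w *m H) 0 t = e * \det H.
Proof.
move=> Hsurj Hw.
have /fin_all_exists [G GE] (i : 'I_n) : exists g : 'rV[R]_n,
    forall j, j != t -> (g *m H) 0 j = (i == j)%:R /\ (i = t -> g = w).
  have [->|ne] := eqVneq i t.
    by exists w => j ne; rewrite Hw // eq_sym (negPf ne).
  have [g gE] := Hsurj (fun j => (i == j)%:R); exists g => j nej.
  by rewrite gE //; split=> // eqi; case/eqP: ne.
pose G' : 'M[R]_n := \matrix_i (if i == t then w else G i).
have rowG i : row i (G' *m H) = (if i == t then w else G i) *m H.
  by rewrite row_mul rowK.
pose d : 'cV[R]_n := \col_i ((G' *m H) i t - (i == t)%:R).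
have dE i j : (d *m (delta_mx 0 t : 'rV_n)) i j = d i 0 * (j == t)%:R.
  by rewrite mxE big_ord1 [delta_mx _ _ _ _]mxE eqxx.
have GH : G' *m H = 1%:M + d *m delta_mx 0 t.
  apply/matrixP=> i j; rewrite [RHS]mxE dE [1%:M i j]mxE [d i 0]mxE.
  have [->|ne] := eqVneq j t; first by rewrite mulr1 addrC subrK.
  rewrite mulr0 addr0; have := congr1 (fun A : 'rV_n => A 0 j) (rowG i).
  rewrite mxE => ->; case: ifP => [/eqP ->|_]; first by rewrite Hw // eq_sym (negPf ne).
  by have [] := GE i j ne.
exists (\det G'); rewrite -det_mulmx GH det_addM det_mx11.
have -> : (w *m H) 0 t = (G' *m H) t t.
  have := congr1 (fun A : 'rV_n => A 0 t) (rowG t); rewrite mxE eqxx => ->.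
  by [].
rewrite -rowE [RHS]mxE [1%:M _ _]mxE [row t d _ _]mxE [d t 0]mxE !eqxx.
by rewrite addrC subrK.
Qed.
End Unitriangular.

Definition lower_part (R : nmodType) n (A : 'M[R]_n) : 'M[R]_n :=
  \matrix_(i, j) if (j < i)%N then A i j else 0.

Lemma lower_partE (R : nmodType) n (A : 'M[R]_n) (i j : 'I_n) :
  (j < i)%N -> lower_part A i j = A i j.
Proof. by move=> lt; rewrite mxE lt. Qed.

(** In column [y] truncation erases only entries in rows [x <= y], which [g] does not see. *)
Lemma mulmx_lower_part (R : pzRingType) n (g : 'rV[R]_n) (A : 'M[R]_n) (y : 'I_n) :
  (forall x : 'I_n, (x <= y)%N -> g 0 x = 0) ->
  (g *m lower_part A) 0 y = (g *m A) 0 y.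
Proof.
move=> g0; rewrite [LHS]mxE [RHS]mxE; apply: eq_bigr => x _; rewrite mxE.
by case: ltnP => // le; rewrite g0 ?mul0r.
Qed.

Definition involution_mx (R : nmodType) n (sigma : 'S_n) (f : 'I_n -> R) : 'M[R]_n :=
  \matrix_(i, j) if (j < i)%N && (i == sigma j) then f j else 0.

Lemma ltnS_leqF (m p : nat) : (p < m.+1)%N -> (m < p)%N = false.
Proof. by rewrite ltnS leqNgt => /negbTE. Qed.

(** * Explicit row combinations of an orbit matrix *)

Section OrbitRows.
Variables (R : comUnitRingType) (n : nat) (sigma : 'S_n) (f : 'I_n -> R).
Variables u v : 'M[R]_n.
Hypothesis sigmaK : involutive sigma.
Hypothesis f_unit : forall j : 'I_n, (j < sigma j)%N -> f j \is a GRing.unit.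
Hypothesis vU : upper_unitri v.
Hypothesis vu : v *m u = 1%:M.

Lemma sigma_val (x y : 'I_n) : sigma x = y :> nat -> x = sigma y :> nat.
Proof. by move/val_inj <-; rewrite sigmaK. Qed.

Let F := involution_mx sigma f.
Let W := u *m F *m v.
Let L := lower_part W.

(** The factor [v] cancels [u], and row [x] of [F] has at most one nonzero entry, in column
    [sigma x]. *)
Lemma orbit_rowE (c : 'rV[R]_n) y : (c *m v *m W) 0 y =
  \sum_x c 0 x * (if (sigma x < x)%N then f (sigma x) * v (sigma x) y else 0).
Proof.
have -> : c *m v *m W = c *m (F *m v).
  by rewrite -!mulmxA; congr (_ *m _); rewrite !mulmxA vu mul1mx.
rewrite mxE; apply: eq_bigr => x _; congr (_ * _).
rewrite mxE (bigD1 (sigma x)) //= mxE sigmaK eqxx andbT big1 ?addr0.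
  by case: ifP => // _; rewrite mul0r.
move=> y' ne; rewrite mxE; case: eqP => [eqx|_]; last by rewrite andbF mul0r.
by case/eqP: ne; rewrite eqx sigmaK.
Qed.

(** The common source of the rows below. One part of [c] carries the combination [a] of rows of [v]
    back along the arcs starting in [T]; the other part, supported on [E], adjusts [c *m v] there.
    The latter is invisible before column [q], because it only brings in rows [sigma x >= q] of
    [v]. *)
Lemma orbit_row_solve (T E : {set 'I_n}) (q : nat) (r h : 'I_n -> R) :
    {in T, forall j : 'I_n, (j < sigma j)%N} ->
    {in E, forall x, (q <= sigma x)%N} ->
  exists c a : 'rV[R]_n, [/\
    forall x, x \notin E -> c 0 x = if sigma x \in T then a 0 (sigma x) / f (sigma x) else 0,
    forall j, j \notin T -> a 0 j = 0,
    {in T, forall j, (a *m v) 0 j = r j},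
    {in E, forall x, (c *m v) 0 x = h x} &
    forall y : 'I_n, (y < q)%N -> (c *m v *m W) 0 y = (a *m v) 0 y].
Proof.
move=> Tlt Eq; have [a [a0 aE]] := upper_unitri_solve T r vU.
pose b : 'rV[R]_n := \row_x if sigma x \in T then a 0 (sigma x) / f (sigma x) else 0.
have [z [z0 zE]] := upper_unitri_solve E (fun x => h x - (b *m v) 0 x) vU.
exists (b + z), a; split=> //.
- by move=> x xE; rewrite mxE z0 // addr0 mxE.
- by move=> x xE; rewrite mulmxDl mxE zE // addrC subrK.
move=> y ltyq; rewrite orbit_rowE [RHS]mxE [RHS](reindex_inj (@perm_inj _ sigma)) /=.
apply: eq_bigr => x _; rewrite mxE mulrDl [b 0 x]mxE [X in _ + X](_ : _ = 0).
  rewrite addr0; case: ifP => [sxT|/negbT /a0 ->]; last by rewrite !mul0r.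
  have := Tlt _ sxT; rewrite sigmaK => lt; rewrite lt mulrA divrK //.
  by apply: f_unit; rewrite sigmaK.
have [xE|/z0 ->] := boolP (x \in E); last by rewrite mul0r.
case: ifP => _; last by rewrite mulr0.
have lt : (y < sigma x)%N by rewrite (leq_trans ltyq) ?Eq.
rewrite vU ?(ltnW lt) //; case: eqP lt => [->|_ _]; first by rewrite ltnn.
by rewrite !mulr0.
Qed.

Lemma mem_Iset k t x : (x \in Iset sigma k t) = (x == k) || ((k < x)%N && (sigma x < t)%N).
Proof.
rewrite in_setU1; congr (_ || _); apply/imsetP/andP => [[j]|[ltk ltt]].
  by rewrite inE => /andP[jt kj] ->; rewrite sigmaK.
by exists (sigma x); rewrite ?inE ?sigmaK ?ltt.
Qed.

Lemma mem_Jset k t x : (x \in Jset sigma k t) = (x == t) || ((x < t)%N && (k < sigma x)%N).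
Proof. by rewrite !inE. Qed.

Section Type0.
Variables k t : 'I_n.
Hypothesis kt : (t < k)%N.
Hypothesis sk : (t <= sigma k)%N.
Hypothesis st : (sigma t <= k)%N.

(** With [T] empty the product vanishes before column [q]. Column [t] can be included unless
    [k = sigma t], since [sigma x = t] with [x] in [E] forces [x = k]. The exceptional case is that
    of an arc, whose minor does not vanish on the orbit. *)
Lemma type0_kernel_row : exists c : 'rV[R]_n, [/\
    forall x : 'I_n, ~~ ((k <= x)%N && (t <= sigma x)%N) -> c 0 x = 0, c 0 k = 1,
    forall x, x \notin Iset sigma k t -> (c *m v) 0 x = 0,
    forall y : 'I_n, (y < t)%N -> (c *m v *m W) 0 y = 0 &
    k != sigma t -> (c *m v *m W) 0 t = 0].
Proof.
pose E := [set x : 'I_n | (k <= x)%N && (t <= sigma x)%N].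
pose q := if k == sigma t then t : nat else t.+1.
have Eq : {in E, forall x, (q <= sigma x)%N}.
  move=> x; rewrite inE /q => /andP[kx]; case: eqP => // ne.
  rewrite leq_eqVlt => /orP[/eqP /val_inj tx|//]; case: ne; apply/val_inj.
  by apply/eqP; rewrite eqn_leq st tx sigmaK kx.
have [] := @orbit_row_solve set0 E q (fun _ => 0) (fun x => (x == k)%:R) _ Eq.
  by move=> j; rewrite inE.
move=> c [a [cE a0 _ cvE cW]].
have c0 x : x \notin E -> c 0 x = 0 by move/cE->; rewrite inE.
have clt (p : 'I_n) : (p < k)%N -> c 0 p = 0.
  by move=> lt; rewrite c0 // inE leqNgt lt.
have aZ : a = 0 by apply/rowP=> j; rewrite mxE a0 ?inE.
exists c; split=> //.
- by move=> x xE; rewrite c0 ?inE.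
- by rewrite -(mulmx_upper_unitri_lead vU clt) cvE ?inE ?leqnn ?eqxx.
- move=> x; rewrite mem_Iset negb_or => /andP[ne xI].
  have [lt|ge] := ltnP x k; first exact: (mulmx_upper_unitri_eq0 vU clt).
  rewrite cvE ?(negPf ne) // inE ge /= leqNgt; apply: contraNN xI => ->.
  by rewrite andbT ltn_neqAle ge andbT eq_sym.
- move=> y lt; rewrite cW ?aZ ?mul0mx ?mxE // /q; case: eqP => // _.
  exact: ltnW.
- by move=> ne; rewrite cW ?aZ ?mul0mx ?mxE // /q (negPf ne).
Qed.

(** Supplies the surjectivity hypothesis of [det_mask_dvd]. Here [E] consists of the rows after [k]
    outside [Iset], so making [c *m v] vanish on [E] confines its support to [Iset]. *)
Lemma type0_rows_full (r : 'I_n -> R) : exists g : 'rV[R]_n,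
  (forall x, x \notin Iset sigma k t -> g 0 x = 0) /\
  {in Jset sigma k t, forall y, y != t -> (g *m L) 0 y = r y}.
Proof.
pose T := J' sigma k t.
pose E := [set x : 'I_n | (k < x)%N && (t <= sigma x)%N].
have [] := @orbit_row_solve T E t r (fun _ => 0).
- by move=> j; rewrite inE => /andP[jt kj]; rewrite (ltn_trans jt) ?(ltn_trans kt).
- by move=> x; rewrite inE => /andP[].
move=> c [a [cE a0 aE cvE cW]].
have clt (p : 'I_n) : (p < k.+1)%N -> c 0 p = 0.
  move=> lt; rewrite cE; last by rewrite inE (ltnS_leqF lt).
  by rewrite inE sigmaK (ltnS_leqF lt) andbF.
exists (c *m v); split.
  move=> x; rewrite mem_Iset negb_or => /andP[ne xI].
  have [lt|ge] := ltnP x k.+1; first exact: (mulmx_upper_unitri_eq0 vU clt).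
  by rewrite cvE // inE ge /= leqNgt; apply: contraNN xI => ->; rewrite ge.
move=> y; rewrite mem_Jset => /predU1P[->|]; first by rewrite eqxx.
case/andP=> yt ky _; rewrite mulmx_lower_part; last first.
  move=> x le; apply: (mulmx_upper_unitri_eq0 vU clt).
  by rewrite ltnS (leq_trans le) // ltnW // (ltn_trans yt).
by rewrite cW // aE // inE yt.
Qed.
End Type0.

Section Type1.
Variables k t : 'I_n.
Hypothesis sk : (sigma t < k)%N.
Hypothesis kt : (k < t)%N.
Hypothesis ti : (t < sigma k)%N.
Let I := Iset sigma k t.
Let J := Jset sigma k t.
Let K1 := [set x : 'I_n | (k < x < t)%N && (t < sigma x)%N].

Lemma type1_inY y : y \in J :\: I ->
  ((y < k) && (k < sigma y))%N \/ y \in K1.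
Proof.
rewrite in_setD mem_Iset mem_Jset inE => /andP[yI]; have := @sigma_val y t.
case: eqP yI => // ny; have {}ny : (y : nat) <> k by move=> /val_inj.
case: (eqVneq y t) => [->|_] /=; lia.
Qed.

Lemma type1_inX (x : 'I_n) : (k < x)%N -> (x \notin I :\: J) ->
  [\/ (t < x)%N && (t < sigma x)%N, (x < t)%N && (k <= sigma x)%N | x = t].
Proof.
move=> kx; rewrite in_setD mem_Iset mem_Jset kx /=; have := @sigma_val x t.
have -> /= : (x == k) = false by apply/eqP=> xk; rewrite xk ltnn in kx.
case: (eqVneq x t) => [->|/eqP nxt]; first by constructor 3.
have {}nxt : (x : nat) <> t by move=> /val_inj.
move=> h1 h2; case: (ltnP x t) => lt; [constructor 2|constructor 1]; lia.
Qed.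

(** Here [w = a *m v] with [a] supported on the arc starts [k |: K1]. Rows of [F] at arc starts are
    zero, whence [w *m W = 0]. The row [c] puts the coefficients of [a], divided by the values of
    [f], at the ends of these arcs; as [a] is 1 at [k], this gives [1 / f k] at [sigma k]. *)
Lemma type1_kernel_row : exists c w : 'rV[R]_n, [/\
    forall x : 'I_n, ~~ ((t < x)%N && ((t < sigma x)%N || (k <= sigma x < t)%N)) ->
      c 0 x = 0,
    c 0 (sigma k) * f k = 1,
    forall x : 'I_n, ~~ ((t < x)%N && (sigma x < t)%N) -> (c *m v) 0 x = 0,
    forall y : 'I_n, (y <= t)%N -> (c *m v *m W) 0 y = w 0 y &
    [/\ w *m W = 0, w 0 k = 1, {in K1, forall y, w 0 y = 0} &
     forall y : 'I_n, (y < k)%N -> w 0 y = 0]].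
Proof.
pose T := k |: K1.
have TP j : j \in T -> [/\ k <= j, j < t & t < sigma j]%N.
  by case/setU1P=> [->|]; rewrite ?inE ?leqnn //; case/andP=> /andP[/ltnW].
pose E := [set x : 'I_n | (t < x)%N && (t < sigma x)%N].
have [] := @orbit_row_solve T E t.+1 (fun x => (x == k)%:R) (fun _ => 0).
- by move=> j /TP[_ jt tj]; apply: ltn_trans tj.
- by move=> x; rewrite inE => /andP[].
move=> c [a [cE a0 aE cvE cW]].
have clt (p : 'I_n) : (p < t.+1)%N -> c 0 p = 0.
  move=> lt; rewrite cE; last by rewrite inE (ltnS_leqF lt).
  by case: ifP => // /TP[_ _]; rewrite sigmaK (ltnS_leqF lt).
have alt (p : 'I_n) : (p < k)%N -> a 0 p = 0.
  by move=> lt; rewrite a0 //; apply: contraTN lt => /TP[]; rewrite leqNgt.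
have aW : a *m v *m W = 0.
  apply/rowP=> y; rewrite orbit_rowE mxE big1 // => x _.
  have [/TP[_ xt tx]|/a0 ->] := boolP (x \in T); last by rewrite mul0r.
  by rewrite ltnNge ltnW ?mulr0 // (ltn_trans xt).
have ak : a 0 k = 1.
  by rewrite -(mulmx_upper_unitri_lead vU alt) aE ?eqxx // setU11.
exists c, (a *m v); split.
- move=> x xE; have [lt|ge] := ltnP x t.+1; first exact: clt.
  move: xE; rewrite ge /= negb_or negb_and => /andP[nt nk].
  rewrite cE; last by rewrite inE negb_and nt orbT.
  by case: ifP => // /TP[le lt]; rewrite le lt in nk.
- rewrite cE; last by rewrite inE sigmaK negb_and -!leqNgt (ltnW kt) orbT.
  by rewrite sigmaK setU11 ak div1r mulVr // f_unit // (ltn_trans kt).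
- move=> x xX; have [lt|ge] := ltnP x t.+1; first exact: (mulmx_upper_unitri_eq0 vU clt).
  by rewrite cvE // inE; have := @sigma_val x t; lia.
- by move=> y le; rewrite cW.
split=> //; first by rewrite aE ?eqxx // setU11.
  move=> y yK; rewrite aE ?in_setU ?yK ?orbT //; case: eqP yK => // ->.
  by rewrite inE ltnn.
by move=> y lt; apply: (mulmx_upper_unitri_eq0 vU alt).
Qed.

(** The vanishing before [k] lets such a row correct the columns [K1] without disturbing the other
    columns of [J :\: I]. *)
Lemma type1_rows_K1 (r : 'I_n -> R) : exists g : 'rV[R]_n, [/\
    forall x : 'I_n, ~~ ((t < x)%N && (sigma x < t)%N) -> g 0 x = 0,
    forall y : 'I_n, (y < k)%N -> (g *m L) 0 y = 0 &
    {in K1, forall y, (g *m L) 0 y = r y}].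
Proof.
pose E := [set x : 'I_n | (t < x)%N && (t < sigma x)%N].
have K1P j : j \in K1 -> [/\ k < j, j < t & t < sigma j]%N.
  by rewrite inE => /andP[/andP[]].
have [] := @orbit_row_solve K1 E t r (fun _ => 0).
- by move=> j /K1P[_ jt tj]; apply: ltn_trans tj.
- by move=> x; rewrite inE => /andP[_ /ltnW].
move=> c [a [cE a0 aE cvE cW]].
have clt (p : 'I_n) : (p < t.+1)%N -> c 0 p = 0.
  move=> lt; rewrite cE; last by rewrite inE (ltnS_leqF lt).
  by case: ifP => // /K1P[_ _]; rewrite sigmaK (ltnS_leqF lt).
have alt (p : 'I_n) : (p < k)%N -> a 0 p = 0.
  by move=> lt; rewrite a0 //; apply: contraTN lt => /K1P[/ltnW]; rewrite leqNgt.
have gW (y : 'I_n) : (y < t)%N -> (c *m v *m L) 0 y = (a *m v) 0 y.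
  move=> lt; rewrite mulmx_lower_part ?cW // => x le.
  by apply: (mulmx_upper_unitri_eq0 vU clt); rewrite ltnW // ltnS (leq_ltn_trans le).
exists (c *m v); split.
- move=> x xX; have [lt|ge] := ltnP x t.+1; first exact: (mulmx_upper_unitri_eq0 vU clt).
  by rewrite cvE // inE; have := @sigma_val x t; lia.
- move=> y lt; rewrite gW ?(ltn_trans lt) //.
  exact: (mulmx_upper_unitri_eq0 vU alt).
by move=> y yK; have [_ yt _] := K1P y yK; rewrite gW ?aE.
Qed.

Lemma type1_rows_Y1 (r : 'I_n -> R) : exists g : 'rV[R]_n,
  (forall x : 'I_n, x \notin t |: (I :\: J) -> g 0 x = 0) /\
  forall y : 'I_n, (y < k)%N -> (k < sigma y)%N -> (g *m L) 0 y = r y.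
Proof.
pose T := [set y : 'I_n | (y < k)%N && (k < sigma y)%N].
pose E := [set x : 'I_n | (k < x)%N && (x \notin t |: (I :\: J))].
have [] := @orbit_row_solve T E k r (fun _ => 0).
- by move=> j; rewrite inE => /andP[jt tj]; apply: ltn_trans tj.
- move=> x; rewrite inE in_setU1 negb_or => /andP[kx /andP[/eqP nt]].
  by case/(type1_inX kx)=> // /andP[_ h] //; rewrite ltnW // (ltn_trans kt).
move=> c [a [cE a0 aE cvE cW]].
have clt (p : 'I_n) : (p < k.+1)%N -> c 0 p = 0.
  move=> lt; rewrite cE; last by rewrite inE (ltnS_leqF lt).
  by rewrite inE sigmaK (ltnS_leqF lt) andbF.
exists (c *m v); split.
  move=> x xX; have [lt|ge] := ltnP x k.+1; first exact: (mulmx_upper_unitri_eq0 vU clt).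
  by rewrite cvE // inE ge.
move=> y lt ky; rewrite mulmx_lower_part; last first.
  move=> x le; apply: (mulmx_upper_unitri_eq0 vU clt).
  by rewrite ltnS ltnW // (leq_ltn_trans le).
by rewrite cW // aE // inE lt ky.
Qed.

Lemma type1_rows_full (r : 'I_n -> R) : exists g : 'rV[R]_n,
  (forall x : 'I_n, x \notin t |: (I :\: J) -> g 0 x = 0) /\
  {in J :\: I, forall y, (g *m L) 0 y = r y}.
Proof.
have [g1 [g10 g1E]] := type1_rows_Y1 r.
have [g2 [g20 g2Y g2K]] := type1_rows_K1 (fun y => r y - (g1 *m L) 0 y).
exists (g1 + g2); split=> [x xX|y /type1_inY[/andP[yk ky]|yK]].
- rewrite mxE g10 // g20 ?addr0 //; apply: contraNN xX => /andP[tx sx].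
  by rewrite in_setU1 in_setD mem_Jset mem_Iset; case: (eqVneq x t) => [->|_]; lia.
- by rewrite mulmxDl mxE g1E // g2Y // addr0.
by rewrite mulmxDl mxE g2K // addrC subrK.
Qed.

(* F^2 = 0 makes w W vanish; rows of L outside J :&: I are combinations of rows
   in I :\: J, so the truncated product is one too. *)
Lemma type1_reduction (w : 'rV[R]_n) : w *m W = 0 ->
    {in K1, forall y, w 0 y = 0} -> (forall y : 'I_n, (y < k)%N -> w 0 y = 0) ->
  exists g : 'rV[R]_n, (forall x : 'I_n, x \notin I :\: J -> g 0 x = 0) /\
  {in J :\: I, forall y, (g *m L) 0 y = \sum_(a in J :&: I) w 0 a * L a y}.
Proof.
move=> wW wK wlt.
pose E := [set x : 'I_n | (t < x)%N && (t < sigma x)%N].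
have [z [z0 zE]] := upper_unitri_solve E (fun x => - w 0 x) vU.
(* From [k] on, [E] is the complement of [I] and [J]. Adding [z *m v] moves the combination of the
   rows [E] onto the rows [I :\: J]; before column [t] nothing changes, as [z] brings in only rows
   [sigma x > t] of [v]. *)
pose g0 : 'rV[R]_n := (\row_x if x \in E then w 0 x else 0) + z *m v.
pose g1 : 'rV[R]_n := \row_x if x \in I :\: J then w 0 x else 0.
have zlt (p : 'I_n) : (p < t.+1)%N -> z 0 p = 0.
  by move=> lt; rewrite z0 // inE (ltnS_leqF lt).
have X2X (x : 'I_n) : (t < x)%N && (sigma x < t)%N -> x \in I :\: J.
  by rewrite in_setD mem_Jset mem_Iset; case: (eqVneq x t) => [->|_]; lia.
have g00 x : x \notin I :\: J -> g0 0 x = 0.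
  move=> xX; rewrite mxE [X in X + _]mxE; case: ifP => [xE|/negbT xE].
    by rewrite zE // subrr.
  rewrite add0r; have [lt|ge] := ltnP x t.+1.
    exact: (mulmx_upper_unitri_eq0 vU zlt).
  case: (@type1_inX x) => [|//|xE'|/andP[lt]|eqx].
  - exact: (ltn_trans kt).
  - by rewrite inE xE' in xE.
  - by rewrite ltnNge (ltnW ge) in lt.
  - by rewrite eqx ltnn in ge.
have g0W (y : 'I_n) : (y < t)%N -> (g0 *m L) 0 y = \sum_(a in E) w 0 a * L a y.
  move=> lt; rewrite mulmxDl mxE [X in _ + X](_ : _ = 0) ?addr0.
    rewrite mxE [RHS]big_mkcond; apply: eq_bigr => x _; rewrite mxE.
    by case: ifP => // _; rewrite mul0r.
  rewrite mulmx_lower_part => [|x le]; last first.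
    by apply: (mulmx_upper_unitri_eq0 vU zlt); rewrite ltnS ltnW // (leq_ltn_trans le).
  rewrite orbit_rowE big1 // => x _.
  have [xE|/z0 ->] := boolP (x \in E); last by rewrite mul0r.
  move: xE; rewrite inE => /andP[_ tx]; case: ifP => _; rewrite ?mulr0 //.
  rewrite vU; last by rewrite ltnW // (ltn_trans lt).
  by case: eqP (ltn_trans lt tx) => [->|_ _]; rewrite ?ltnn ?mulr0.
pose h y := \sum_(a in J :&: I) w 0 a * L a y.
(* Before column [k] the relation [w *m W = 0] survives truncation and yields the claim. On [K1] it
   need not survive, and [g2] prescribes the right values there. *)
have [g2 [g20 g2Y g2K]] := type1_rows_K1 (fun y => h y + ((g1 + g0) *m L) 0 y).
exists (g2 - (g1 + g0)); split=> [x xX|y yY].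
  rewrite mxE g20; last by apply: contraNN xX => /X2X.
  by rewrite add0r mxE mxE g00 // [g1 _ _]mxE (negPf xX) addr0 oppr0.
rewrite mulmxBl mxE [X in _ + X]mxE -/(h y).
case/type1_inY: (yY) => [/andP[yk ky]|yK]; last by rewrite g2K // addrK.
rewrite g2Y // add0r; apply/eqP; rewrite eqr_oppLR; apply/eqP.
have yt : (y < t)%N := ltn_trans yk kt.
rewrite mulmxDl mxE g0W // [X in X + _]mxE.
rewrite (eq_bigr (fun x => if x \in I :\: J then w 0 x * L x y else 0)); last first.
  by move=> x _; rewrite mxE; case: ifP => // _; rewrite mul0r.
apply/eqP; rewrite -subr_eq0 opprK /h -big_mkcond; apply/eqP.
have wL : (w *m L) 0 y = 0.
  rewrite mulmx_lower_part ?wW ?mxE // => x le.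
  by apply: wlt; apply: leq_ltn_trans yk.
apply: (etrans _ wL); rewrite [RHS]mxE.
rewrite [X in X + _ + _]big_mkcond [X in _ + _ + X]big_mkcond [X in _ + X + _]big_mkcond.
rewrite -!big_split /=.
apply: eq_bigr => x _; have [lt|kx] := ltnP x k; first by rewrite wlt // !mul0r !if_same !addr0.
rewrite !in_setD in_setI [x \in E]inE.
have sx := @sigma_val x t; have sx' := @sigma_val x k.
have [xI|xI] := boolP (x \in I); have [xJ|xJ] := boolP (x \in J) => /=.
- have -> : (t < x)%N && (t < sigma x)%N = false.
    by move: xJ; rewrite mem_Jset; case: (eqVneq x t) => [->|_]; lia.
  by rewrite !add0r.
- have -> : (t < x)%N && (t < sigma x)%N = false.
    by move: xI; rewrite mem_Iset; case: (eqVneq x k) => [->|_]; lia.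
  by rewrite !addr0.
- have : x \in J :\: I by rewrite in_setD xI.
  case/type1_inY=> [/andP[lt _]|/wK ->]; first by rewrite ltnNge kx in lt.
  by rewrite !mul0r if_same !addr0.
have -> : (t < x)%N && (t < sigma x)%N.
  move: xI xJ; rewrite mem_Iset mem_Jset; case: (eqVneq x k) => //; case: (eqVneq x t) => //.
  move=> /eqP nxt /eqP nxk; have {}nxt : (x : nat) <> t by move=> /val_inj.
  have {}nxk : (x : nat) <> k by move=> /val_inj.
  by move=> /=; lia.
by rewrite !add0r addr0.
Qed.
End Type1.
End OrbitRows.

(** * Minors of orbit points *)

Section ReindexedRows.
Variables (R : comUnitRingType) (n : nat) (I J : {set 'I_n}) (theta : 'I_n -> 'I_n).
Hypothesis cardIJ : #|I| = #|J|.
Hypothesis thI : {in J, forall j, theta j \in I}.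
Hypothesis th_inj : {in J &, injective theta}.

Lemma imset_theta : theta @: J = I.
Proof.
apply/eqP; rewrite eqEcard card_in_imset // cardIJ leqnn andbT.
by apply/subsetP=> x /imsetP[j jJ ->]; apply: thI.
Qed.

(** Masked matrices index their rows by [J]; this transports a row of coefficients living on the row
    set [I]. *)
Definition reindex_row (g : 'rV[R]_n) : 'rV[R]_n :=
  \row_j if j \in J then g 0 (theta j) else 0.

Lemma mulmx_reindex_row (g : 'rV[R]_n) (B : 'M[R]_n) y :
    (forall x, x \notin I -> g 0 x = 0) ->
  (reindex_row g *m mask J (\matrix_(i, j) B (theta i) j)) 0 y =
    if y \in J then (g *m B) 0 y else 0.
Proof.
move=> g0; rewrite mulmx_mask => [|x /negPf xJ]; last by rewrite mxE xJ.
case: ifP => // _; rewrite [LHS]mxE [RHS]mxE.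
rewrite [RHS](bigID (mem I)) /= [X in _ + X]big1 ?addr0; last first.
  by move=> x /g0 ->; rewrite mul0r.
rewrite -imset_theta big_imset //= [RHS]big_mkcond; apply: eq_bigr => j _.
by rewrite !mxE; case: ifP => // _; rewrite mul0r.
Qed.

Lemma det_mask_dvd (B : 'M[R]_n) (t : 'I_n) (w : 'rV[R]_n) : t \in J ->
    (forall r : 'I_n -> R, exists g : 'rV[R]_n,
      (forall x, x \notin I -> g 0 x = 0) /\
      {in J, forall y, y != t -> (g *m B) 0 y = r y}) ->
    (forall x, x \notin I -> w 0 x = 0) ->
    {in J, forall y, y != t -> (w *m B) 0 y = 0} ->
  exists e : R, (w *m B) 0 t = e * \det (mask J (\matrix_(i, j) B (theta i) j)).
Proof.
move=> tJ Bfull w0 wB; set H := mask _ _.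
have [] := @det_dvd_of_rows _ _ H t (reindex_row w).
- move=> r; have [g [g0 gE]] := Bfull r.
  (* Outside [J] the masked matrix is the identity, so the values prescribed there are attained
     trivially. *)
  pose g' : 'rV[R]_n := \row_j if j \in J then 0 else r j.
  exists (reindex_row g + g') => j ne.
  rewrite mulmxDl mxE mulmx_reindex_row //.
  have -> : (g' *m H) 0 j = if j \in J then 0 else r j.
    rewrite mxE (bigD1 j) //= big1 ?addr0 => [|i nij].
      by rewrite mxE maskE; case: (j \in J); rewrite ?mul0r // eqxx mulr1.
    rewrite mxE maskE; case: (i \in J); first by rewrite mul0r.
    by rewrite (negPf nij) mulr0.
  by case: ifP => jJ; rewrite ?add0r // addr0 gE.
- by move=> j ne; rewrite mulmx_reindex_row //; case: ifP => // jJ; rewrite wB.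
by move=> e; rewrite mulmx_reindex_row // tJ => eE; exists e.
Qed.

(* As z = alpha + X beta satisfies z (M0 + X M1) = X^2 beta M1, multiplying by
   the adjugate shows that X^2 divides z det (M0 + X M1). *)
Lemma det_linear_pencil_coef01 (M0 M1 : 'M[R]_n) (alpha beta : 'rV[R]_n) k :
    alpha *m M0 = 0 -> alpha *m M1 + beta *m M0 = 0 -> alpha 0 k = 1 ->
  let D := \det (map_mx polyC M0 + 'X *: map_mx polyC M1) in
  D`_0 = 0 /\ D`_1 = 0.
Proof.
move=> aM0 abM ak; set A := map_mx _ _ + _ => D.
pose z : 'rV[{poly R}]_n := map_mx polyC alpha + 'X *: map_mx polyC beta.
have zA : z *m A = 'X^2 *: map_mx polyC (beta *m M1).
  rewrite mulmxDl !mulmxDr -!scalemxAl -!scalemxAr -!map_mxM aM0 raddf0 add0r.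
  by rewrite addrA -scalerDr -map_mxD abM raddf0 scaler0 add0r scalerA map_mxM expr2.
have : D *: z = 'X^2 *: (map_mx polyC (beta *m M1) *m \adj A).
  by rewrite scalemxAl -zA -mulmxA mul_mx_adj mul_mx_scalar.
have zk : z 0 k = 1 + 'X * (beta 0 k)%:P by rewrite !mxE ak.
move/rowP/(_ k); rewrite [LHS]mxE [RHS]mxE zk; set s := (_ *m _) 0 k => DE.
have /(congr1 (coefp 0)) := DE; have /(congr1 (coefp 1%N)) := DE.
rewrite /= !coefXnM /= mulrDr mulr1 !coefD mulrCA !coefXM /= addr0 coefMC.
by move=> + D0; rewrite D0 mul0r addr0.
Qed.
End ReindexedRows.

Lemma det_conj_perm (R : comNzRingType) n (s : 'S_n) (A : 'M[R]_n) :
  \det (\matrix_(i, j) A (s i) (s j)) = \det A.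
Proof.
have -> : \matrix_(i, j) A (s i) (s j) = row_perm s (col_perm s A).
  by apply/matrixP=> i j; rewrite !mxE.
rewrite row_permE col_permE !det_mulmx !det_perm odd_permV mulrCA -signr_addb.
by rewrite addbb mulr1.
Qed.

Section OrbitMinors.
Variables (R : comUnitRingType) (n : nat) (sigma : 'S_n) (f : 'I_n -> R).
Variables u v : 'M[R]_n.
Hypothesis sigmaK : involutive sigma.
Hypothesis f_unit : forall j : 'I_n, (j < sigma j)%N -> f j \is a GRing.unit.
Hypothesis uU : upper_unitri u.
Hypothesis vU : upper_unitri v.
Hypothesis vu : v *m u = 1%:M.
Let W := u *m involution_mx sigma f *m v.
Let L := lower_part W.
Variables k t : 'I_n.
Let I := Iset sigma k t.
Let J := Jset sigma k t.

(** In an entry of the block with rows [sigma @: J] and columns [J], an arc starting at [a]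
    contributes only if [a <= t], by the shape of [v], and [k <= sigma a], by that of [u]; this
    means that [a] is in [J]. The block is thus a unitriangular block of [u], times a diagonal,
    times one of [v]; truncation does not reach it because its rows are at least [k > t]. *)
Lemma orbit_arc_minor : (t < k)%N -> sigma t = k ->
  \det (mask J (\matrix_(i, j) L (sigma i) j)) = \prod_(j in J) f j.
Proof.
move=> tk stk; pose d : 'rV[R]_n := \row_j if j \in J then f j else 1.
pose U := mask J (\matrix_(i, j) u (sigma i) (sigma j)).
have UE i j : U i j = if (i \in J) && (j \in J) then u (sigma i) (sigma j) else (i == j)%:R.
  by rewrite maskE mxE.
have JP j : j \in J -> (j <= t)%N /\ (k <= sigma j)%N.
  by rewrite mem_Jset => /predU1P[->|/andP[/ltnW ? /ltnW ?]] //; rewrite stk.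
have -> : mask J (\matrix_(i, j) L (sigma i) j) = U *m diag_mx d *m mask J v.
  apply/matrixP=> i j; rewrite mxE; case: ifP => [/andP[iJ jJ]|].
    have [_ ki] := JP _ iJ; have [jt _] := JP _ jJ.
    rewrite mxE lower_partE ?(leq_ltn_trans jt) ?(leq_trans tk) //.
    rewrite /W -mulmxA [LHS]mxE [RHS]mxE [LHS](reindex_inj (@perm_inj _ sigma)) /=.
    apply: eq_bigr => a _; rewrite mul_mx_diag.
    rewrite [X in _ = X * _]mxE UE maskE iJ jJ /= andbT.
    rewrite [X in _ * X = _]mxE (bigD1 a) //= mxE eqxx andbT big1 ?addr0; last first.
      move=> b ne; rewrite mxE (inj_eq perm_inj) [a == b]eq_sym (negPf ne) andbF.
      by rewrite mul0r.
    have [aJ|aJ] := boolP (a \in J).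
      have [at_ ka] := JP _ aJ; rewrite [d 0 a]mxE aJ mulrA.
      by rewrite (leq_ltn_trans at_) // (leq_trans tk).
    rewrite [d 0 a]mxE (negPf aJ) mulr1 [RHS](_ : _ = 0); last first.
      by case: eqP iJ aJ => [->->//|_ _ _]; rewrite mul0r.
    case: ifP => [lt|_]; last by rewrite mul0r mulr0.
    have [la|la] := leqP a t; last first.
      by rewrite vU ?(leq_trans jt (ltnW la)) //; case: eqP la => [->|]; rewrite ?mulr0 // ltnNge jt.
    have [sa|sa] := leqP k (sigma a); last first.
      rewrite uU ?(leq_trans (ltnW sa)) //; case: eqP sa => [<-|]; rewrite ?mul0r //.
      by rewrite ltnNge ki.
    case/negP: aJ; rewrite mem_Jset; case: eqVneq => //= ne.
    rewrite !ltn_neqAle la sa !andbT ne /=; apply: contra_neq ne => ks.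
    by apply: (@perm_inj _ sigma); rewrite stk; apply: val_inj.
  move=> ij; rewrite mxE; under eq_bigr => a _ do rewrite mul_mx_diag mxE UE maskE.
  have [iJ|iJ] := boolP (i \in J); last first.
    rewrite (bigD1 i) //= (negPf iJ) eqxx mxE (negPf iJ) !mul1r big1 ?addr0 // => a.
    by rewrite eq_sym => /negPf ->; rewrite !mul0r.
  have {ij}jJ : j \notin J by move: ij; rewrite iJ => /negbT.
  rewrite (bigD1 j) //= (negPf jJ) eqxx mxE (negPf jJ) !mulr1 big1 ?addr0 // => a.
  by rewrite andbF => /negPf ->; rewrite mulr0.
rewrite !det_mulmx (det_upper_unitri (upper_unitri_mask J vU)) mulr1.
have -> : \det U = 1.
  rewrite -(det_upper_unitri (upper_unitri_mask (sigma @: J) uU)).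
  rewrite -(det_conj_perm sigma (mask _ u)); congr (\det _); apply/matrixP=> i j.
  by rewrite !mxE !(mem_imset _ _ (@perm_inj _ sigma)) (inj_eq perm_inj).
rewrite mul1r det_diag [RHS]big_mkcond; apply: eq_bigr => j _.
by rewrite mxE.
Qed.

Variable theta : 'I_n -> 'I_n.
Hypothesis thI : {in J, forall j, theta j \in I}.
Hypothesis th_inj : {in J &, injective theta}.
Let cardIJ : #|I| = #|J| := card_IJ sigma k t.

(** The kernel row has the entry 1 at [k], so multiplying by the adjugate kills the determinant over
    any ring. *)
Lemma orbit_type0_minor0 : (t < k)%N -> (t <= sigma k)%N -> (sigma t < k)%N ->
  \det (mask J (\matrix_(i, j) L (theta i) j)) = 0.
Proof.
move=> tk sk st.
have [c [c0 ck w0 wlt wt]] := @type0_kernel_row _ _ sigma f u v sigmaK f_unit vU vu k t sk (ltnW st).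
have clt (p : 'I_n) : (p < k)%N -> c 0 p = 0 by move=> lt; rewrite c0 // leqNgt lt.
have /imsetP[j jJ jk] : k \in theta @: J by rewrite (imset_theta cardIJ) // setU11.
set H := mask _ _.
have wH : reindex_row J theta (c *m v) *m H = 0.
  apply/rowP=> y; rewrite (mulmx_reindex_row cardIJ) // [RHS]mxE; case: ifP => //.
  rewrite mem_Jset => yJ; have yt : (y <= t)%N.
    by case/predU1P: yJ => [->//|/andP[/ltnW]].
  rewrite mulmx_lower_part => [|x le]; last first.
    by apply: (mulmx_upper_unitri_eq0 vU clt); rewrite (leq_ltn_trans le) // (leq_ltn_trans yt).
  case/predU1P: yJ => [->|/andP[lt _]]; last exact: wlt.
  by apply: wt; apply: contraTneq st => ->; rewrite ltnn.
have := congr1 (mulmx^~ (\adj H)) wH; rewrite -mulmxA mul_mx_adj mul0mx mul_mx_scalar.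
move/rowP/(_ j); rewrite [LHS]mxE [RHS]mxE mxE jJ -jk (mulmx_upper_unitri_lead vU clt) ck.
by rewrite mulr1.
Qed.

(** The kernel row annihilates the columns of [J] other than [t], so its pairing with any new column
    [t] is a multiple of the resulting minor. The support of [c] and [c 0 k = 1] are recorded
    because they make these linear forms triangular. *)
Lemma orbit_type0_dvd (delta : 'I_n -> R) :
    (t < k)%N -> (t <= sigma k)%N -> (sigma t <= k)%N ->
  exists (c : 'rV[R]_n) (e : R), [/\
    forall x : 'I_n, ~~ ((k <= x)%N && (t <= sigma x)%N) -> c 0 x = 0, c 0 k = 1 &
    \sum_x (c *m v) 0 x * delta x = e * \det (mask J
      (\matrix_(i, j) if j == t then delta (theta i) else L (theta i) j))].
Proof.
move=> tk sk st.
have [c [c0 ck w0 wlt _]] := @type0_kernel_row _ _ sigma f u v sigmaK f_unit vU vu k t sk st.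
have clt (p : 'I_n) : (p < k)%N -> c 0 p = 0 by move=> lt; rewrite c0 // leqNgt lt.
pose B := \matrix_(x, j) if j == t then delta x else L x j.
have BL (g : 'rV[R]_n) y : y != t -> (g *m B) 0 y = (g *m L) 0 y.
  by move=> ne; rewrite !mxE; apply: eq_bigr => x _; rewrite mxE (negPf ne).
have [||||e] := @det_mask_dvd _ _ I J theta cardIJ thI th_inj B t (c *m v).
- by rewrite mem_Jset eqxx.
- move=> r; have [g [g0 gE]] := @type0_rows_full _ _ sigma f u v sigmaK f_unit vU vu k t tk r.
  by exists g; split=> // y yJ ne; rewrite BL // gE.
- exact: w0.
- move=> y; rewrite mem_Jset => /predU1P[->|/andP[lt _] ne]; first by rewrite eqxx.
  rewrite BL // mulmx_lower_part ?wlt // => x le.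
  by apply: (mulmx_upper_unitri_eq0 vU clt); rewrite (leq_ltn_trans le) // (ltn_trans lt).
rewrite mxE => eE; exists c, e; split=> //.
rewrite (eq_bigr (fun x => (c *m v) 0 x * B x t)); last by move=> x _; rewrite [B x t]mxE eqxx.
rewrite eE; congr (_ * \det (mask _ _)); by apply/matrixP=> i j; rewrite !mxE.
Qed.

Section Type1.
Hypothesis sk : (sigma t < k)%N.
Hypothesis kt : (k < t)%N.
Hypothesis ti : (t < sigma k)%N.
Hypothesis th_id : {in J :&: I, forall j, theta j = j}.
Let C := J :&: I.

Lemma theta_notinJ j : j \in J -> j \notin I -> theta j \notin J.
Proof.
move=> jJ; apply: contraNN => thJ.
have thC : theta j \in J :&: I by rewrite in_setI thJ thI.
by rewrite -(th_inj thJ jJ (th_id thC)) thI.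
Qed.

Lemma kJ : k \in J. Proof. by rewrite mem_Jset kt (ltn_trans kt ti) /= orbT. Qed.
Lemma tI : t \in I. Proof. by rewrite mem_Iset // kt (ltn_trans sk kt) /= orbT. Qed.

Lemma orbit_type1_coef1 : (\det (pencil J C theta L))`_1 = 0.
Proof.
have [c [w [_ _ w0 wW [wW0 wk wK wlt]]]] :=
  @type1_kernel_row _ _ sigma f u v sigmaK f_unit vU vu k t sk kt ti.
have [g [g0 gE]] :=
  @type1_reduction _ _ sigma f u v sigmaK f_unit vU vu k t sk kt ti w wW0 wK wlt.
pose M0 := mask J (\matrix_(i, j) if i \in C then (i == j)%:R else L (theta i) j).
pose M1 : 'M[R]_n := \matrix_(i, j) if (i \in C) && (j \in J) then L i j else 0.
(* The unit rows are the constant terms of the pencil rows in [C]; with them [M0] is a reindexing of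
   one matrix, as [mulmx_reindex_row] requires. *)
pose B : 'M[R]_n := \matrix_(x, j) if x \in J then (x == j)%:R else L x j.
have M0E : M0 = mask J (\matrix_(i, j) B (theta i) j).
  apply/matrixP=> i j; rewrite !maskE; case: ifP => // /andP[iJ jJ]; rewrite !mxE.
  rewrite in_setI iJ /=; have [iI|iI] := boolP (i \in I); first by rewrite th_id ?in_setI ?iJ.
  by rewrite (negPf (theta_notinJ iJ iI)).
pose row_on (a b : 'rV[R]_n) : 'rV[R]_n := \row_x if x \in C then a 0 x
  else if x \in I then b 0 x else 0.
have row_on0 (a b : 'rV[R]_n) x : x \notin I -> row_on a b 0 x = 0.
  by move=> xI; rewrite mxE in_setI (negPf xI) andbF.
have row_onB (a b : 'rV[R]_n) y : y \in J -> (forall x : 'I_n, x \notin I :\: J -> b 0 x = 0) ->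
    (row_on a b *m B) 0 y = (if y \in C then a 0 y else 0) + (b *m L) 0 y.
  move=> yJ b0; rewrite [LHS]mxE (bigID (mem C)) /=; congr (_ + _).
    have [yC|yC] := boolP (y \in C); last first.
      rewrite big1 // => x xC; move: (xC); rewrite in_setI => /andP[xJ _].
      rewrite [B _ _]mxE xJ; case: eqP xC => [->|_ _]; first by rewrite (negPf yC).
      by rewrite mulr0.
    rewrite (bigD1 y) //= big1 ?addr0 => [|x /andP[xC ne]].
      by rewrite !mxE yC yJ eqxx mulr1.
    by move: xC; rewrite in_setI [B _ _]mxE => /andP[-> _]; rewrite (negPf ne) mulr0.
  rewrite [RHS]mxE [LHS]big_mkcond; apply: eq_bigr => x _.
  have [xX|xX] := boolP (x \in I :\: J).
    move: (xX); rewrite in_setD [x \in C]in_setI => /andP[xJ xI].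
    by rewrite !mxE in_setI (negPf xJ) xI.
  rewrite b0 // mul0r; case: ifP => // xC; rewrite mxE (negPf xC) b0 // if_same.
  by rewrite mul0r.
(* The rows of [M0] in [C] are unit rows, so [h] can be chosen to satisfy the second relation on the
   columns [C]; on [J :\: I] that relation is the one provided by [type1_reduction]. *)
pose h : 'rV[R]_n := \row_a ((g *m L) 0 a - \sum_(a' in C) w 0 a' * L a' a).
have w0' x : x \notin I :\: J -> (- (c *m v)) 0 x = 0.
  move=> xX; rewrite mxE w0 ?oppr0 //; apply: contraNN xX.
  by rewrite in_setD mem_Jset mem_Iset //; case: (eqVneq x t) => [->|_]; lia.
pose alpha := reindex_row J theta (row_on w (- (c *m v))).
pose beta := reindex_row J theta (row_on h (- g)).
have wL y : y \in J -> (c *m v *m L) 0 y = w 0 y.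
  rewrite mem_Jset => yJ; have yt : (y <= t)%N.
    by case/predU1P: yJ => [->//|/andP[/ltnW]].
  rewrite mulmx_lower_part ?wW // => x le; apply: w0.
  by rewrite ltnNge (leq_trans le).
have [|||_ D1] := @det_linear_pencil_coef01 _ _ M0 M1 alpha beta k.
- apply/rowP=> y; rewrite M0E /alpha (mulmx_reindex_row cardIJ) //; last exact: row_on0.
  rewrite [RHS]mxE.
  case: ifP => // yJ; rewrite row_onB // mulNmx [(- (_ *m _)) _ _]mxE wL //.
  case: ifP => [_|yC]; first by rewrite subrr.
  have yY : y \in J :\: I by move: yC; rewrite in_setI in_setD yJ andbT => /negbT.
  have [/andP[yk _]|yK] := type1_inY sigmaK sk kt ti yY; last by rewrite wK // subrr.
  by rewrite wlt // subrr.
- apply/rowP=> y; rewrite mxE M0E /beta (mulmx_reindex_row cardIJ) //; last exact: row_on0.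
  rewrite [RHS]mxE.
  have -> : (alpha *m M1) 0 y = if y \in J then \sum_(a in C) w 0 a * L a y else 0.
    rewrite mxE (bigID (mem C)) /= [X in _ + X]big1 ?addr0; last first.
      by move=> a aC; rewrite [M1 _ _]mxE (negPf aC) mulr0.
    case: ifP => yJ; last by rewrite big1 // => a aC; rewrite [M1 _ _]mxE yJ andbF mulr0.
    apply: eq_bigr => a aC; rewrite [M1 _ _]mxE aC yJ /=; congr (_ * _).
    by move: (aC); rewrite in_setI => /andP[aJ _]; rewrite mxE aJ mxE th_id // aC.
  case: ifP => // yJ; last by rewrite addr0.
  rewrite row_onB // => [|x xX]; last by rewrite mxE g0 ?oppr0.
  rewrite mulNmx [(- (_ *m _)) _ _]mxE; case: ifP => yC.
    by rewrite [h 0 y]mxE addrC addrAC subrK subrr.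
  have yY : y \in J :\: I by move: yC; rewrite in_setI in_setD yJ andbT => /negbT.
  by rewrite gE // add0r subrr.
- have kC : k \in C by rewrite in_setI kJ mem_Iset // eqxx.
  by rewrite mxE kJ mxE th_id ?kC.
rewrite -[RHS]D1; congr ((polyseq (\det _))`_ _); apply/matrixP=> i j.
rewrite !mxE; have [iJ|iJ] := boolP (i \in J) => /=; last first.
  by rewrite in_setI (negPf iJ) /= mulr0 addr0 rmorph_nat.
case: ifP => jJ; last by rewrite andbF mulr0 addr0 rmorph_nat.
by rewrite andbT; case: ifP => _; rewrite ?mulr0 ?addr0 // rmorph_nat.
Qed.

Lemma orbit_type1_dvd (delta : 'I_n -> R) (L1 : 'M[R]_n) :
    (forall x : 'I_n, (x <= t)%N -> delta x = 0) ->
    (forall x j : 'I_n, (j < t)%N -> L1 x j = L x j) ->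
    (forall x, L1 x t = L x t + delta x) ->
  exists (c : 'rV[R]_n) (e : R), [/\
    forall x : 'I_n, ~~ ((t < x)%N && ((t < sigma x)%N || (k <= sigma x < t)%N)) ->
      c 0 x = 0,
    c 0 (sigma k) * f k = 1 &
    \sum_x (c *m v) 0 x * delta x = e * (\det (pencil J C theta L1))`_1].
Proof.
move=> d0 L1lt L1t.
have [c [w [c0 ck w0 wW [wW0 wk wK wlt]]]] :=
  @type1_kernel_row _ _ sigma f u v sigmaK f_unit vU vu k t sk kt ti.
have Jle j : j \in J -> j != t -> (j < t)%N.
  by rewrite mem_Jset => /predU1P[->|/andP[]]; rewrite ?eqxx.
have tC : t \in C by rewrite in_setI mem_Jset eqxx tI.
pose B : 'M[R]_n := \matrix_(x, j) if (x \in J) && (x != t) then (x == j)%:R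
  else if j == t then delta x else L x j.
have -> : (\det (pencil J C theta L1))`_1 =
    \det (mask J (\matrix_(i, j) B (theta i) j)).
  pose P := pencil J C theta L.
  (* The increment of column [t]. Rows in [C] receive 0, since their indices are at most [t], where
     [delta] vanishes. *)
  pose P1 : 'M[{poly R}]_n := \matrix_(i, j) if j == t then
    (if (i \in J) && (i \notin C) then (delta (theta i))%:P else 0) else P i j.
  have P1E i j : P1 i j = if j == t then
      (if (i \in J) && (i \notin C) then (delta (theta i))%:P else 0) else P i j.
    by rewrite mxE.
  have tJ : t \in J by rewrite mem_Jset eqxx.
  have L1P i j : j != t -> pencil J C theta L1 i j = P i j.
    move=> ne; rewrite /P !pencilE; case: ifP => // /andP[_ jJ].
    by rewrite !(L1lt _ _ (Jle _ jJ ne)).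
  have -> : \det (pencil J C theta L1) = \det P + \det P1.
    apply: (@det_col_add _ _ _ _ _ t) => [i|i j ne|i j ne].
    - rewrite P1E eqxx /P !pencilE tJ andbT.
      have [iJ|iJ] := boolP (i \in J) => /=; last by rewrite addr0.
      have [iC|iC] /= := boolP (i \in C); last by rewrite L1t polyCD.
      rewrite L1t (d0 i) ?addr0 //; move: iC; rewrite in_setI mem_Jset.
      by case/andP=> /predU1P[->//|/andP[/ltnW]].
    - by rewrite L1P.
    - by rewrite P1E (negPf ne) L1P.
  rewrite coefD orbit_type1_coef1 add0r.
  pose d : 'rV[{poly R}]_n := \row_j if j == t then 'X else 1.
  (* With its diagonal entry gone, row [t] is divisible by ['X]. Taking this factor out turns the
     coefficient of degree 1 into a constant coefficient, that is, into an ordinary determinant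
     linear in [delta]. *)
  pose P2 : 'M[{poly R}]_n := \matrix_(i, j) if (i == t) && (j \in J) then
     (if j == t then 0 else (L t j)%:P) else P1 i j.
  have dE i : d 0 i = if i == t then 'X else 1 by rewrite mxE.
  have P2E i j : P2 i j = if (i == t) && (j \in J) then
      (if j == t then 0 else (L t j)%:P) else P1 i j by rewrite mxE.
  have PtE j : j != t -> P t j = if j \in J then 'X * (L t j)%:P else 0.
    by move=> ne; rewrite /P pencilE tJ tC eq_sym (negPf ne) add0r.
  have -> : P1 = diag_mx d *m P2.
    apply/matrixP=> i j; rewrite mul_diag_mx [RHS]mxE dE P2E.
    case: (eqVneq i t) => [->|_] /=; last by rewrite mul1r.
    rewrite P1E tC andbF; case: (eqVneq j t) => [->|ne]; first by rewrite tJ mulr0.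
    by rewrite PtE //; case: ifP => // _; rewrite mulr0.
  rewrite det_mulmx det_diag (bigD1 t) //= dE eqxx big1 ?mulr1; last first.
    by move=> i /negPf ne; rewrite dE ne.
  rewrite coefXM /= -[LHS]/(coefp 0 _) -det_map_mx; congr (\det _).
  have cB (b : bool) : (b%:R : {poly R})`_0 = b%:R.
    by rewrite -[LHS]/(coefp 0 _) rmorph_nat.
  apply/matrixP=> i j; rewrite maskE mxE P2E [in RHS]mxE [B _ _]mxE /=.
  have [->|nit] := eqVneq i t.
    rewrite tJ th_id // tJ eqxx /=; have [jJ|jJ] := boolP (j \in J).
      by case: eqP => _; rewrite ?d0 ?coef0 // coefC.
    have ne : j != t by apply: contraNneq jJ => ->.
    by rewrite P1E (negPf ne) PtE // (negPf jJ) coef0 eq_sym (negPf ne).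
  rewrite P1E; have [iJ|iJ] := boolP (i \in J) => /=; last first.
    case: (eqVneq j t) => [->|_]; first by rewrite coef0 (negPf nit).
    by rewrite /P pencilE (negPf iJ) cB.
  have [iC|iC] /= := boolP (i \in C).
    rewrite th_id // iJ nit; case: (eqVneq j t) => [->|ne].
      by rewrite tJ (negPf nit) coef0.
    rewrite /P pencilE iJ iC /=; case: ifP => jJ; last by rewrite cB.
    by rewrite coefD coefXM addr0 cB.
  have iI : i \notin I by apply: contraNN iC => iI; rewrite in_setI iJ.
  rewrite (negPf (theta_notinJ iJ iI)); case: (eqVneq j t) => [->|ne].
    by rewrite tJ coefC.
  rewrite /P pencilE iJ (negPf iC) /=; case: ifP => jJ; last by rewrite cB.
  by rewrite coefC.
(* On the columns of [C] other than [t] the row [c *m v *m L] equals [w]; the unit rows of [B]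
   cancel these values. *)
pose w' : 'rV[R]_n := c *m v - \row_x (if (x \in C) && (x != t) then w 0 x else 0).
have X2X (x : 'I_n) : (t < x)%N && (sigma x < t)%N -> x \in I :\: J.
  by rewrite in_setD mem_Jset mem_Iset //; case: (eqVneq x t) => [->|_]; lia.
have cv0 x : x \notin I :\: J -> (c *m v) 0 x = 0.
  by move=> xX; apply: w0; apply: contraNN xX => /X2X.
have unitB (b : 'I_n -> R) y :
    ((\row_x (if (x \in C) && (x != t) then b x else 0) : 'rV[R]_n) *m B) 0 y =
    if (y \in C) && (y != t) then b y else 0.
  rewrite mxE (bigD1 y) //= big1 ?addr0 => [|x ne].
    rewrite !mxE in_setI; case: (y \in J) => /=; rewrite ?mul0r //.
    case: ifP => [/andP[_ ->]|_]; last by rewrite mul0r.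
    by rewrite eqxx mulr1.
  rewrite !mxE in_setI; case: (x \in J) => /=; rewrite ?mul0r //.
  case: ifP => [/andP[_ ->]|_]; last by rewrite mul0r.
  by rewrite (negPf ne) mulr0.
have BL (g : 'rV[R]_n) y : y != t ->
    (forall x : 'I_n, x \notin t |: (I :\: J) -> g 0 x = 0) ->
    (g *m B) 0 y = (g *m L) 0 y.
  move=> ne g0; rewrite !mxE; apply: eq_bigr => x _; rewrite mxE (negPf ne).
  case: ifP => // /andP[xJ nxt]; rewrite g0 ?mul0r //.
  by rewrite in_setU1 in_setD negb_or nxt xJ.
have Bt (g : 'rV[R]_n) : (forall x : 'I_n, x \notin t |: (I :\: J) -> g 0 x = 0) ->
    (g *m B) 0 t = \sum_x g 0 x * delta x.
  move=> g0; rewrite !mxE; apply: eq_bigr => x _; rewrite mxE eqxx.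
  case: ifP => // /andP[xJ nxt]; rewrite g0 ?mul0r //.
  by rewrite in_setU1 in_setD negb_or nxt xJ.
have cv0' x : x \notin t |: (I :\: J) -> (c *m v) 0 x = 0.
  by rewrite in_setU1 negb_or => /andP[_ /cv0].
have wL (y : 'I_n) : (y <= t)%N -> (c *m v *m L) 0 y = w 0 y.
  by move=> yt; rewrite mulmx_lower_part ?wW // => x le; apply: w0; rewrite ltnNge (leq_trans le).
have [||||e] := @det_mask_dvd _ _ I J theta cardIJ thI th_inj B t w'.
- by rewrite mem_Jset eqxx.
- move=> r; have [g [g0 gE]] :=
    @type1_rows_full _ _ sigma f u v sigmaK f_unit vU vu k t sk kt ti r.
  exists (g + \row_x (if (x \in C) && (x != t) then r x - (g *m B) 0 x else 0)).
  split=> [x xI|y yJ ne].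
    rewrite mxE g0 ?add0r; last first.
      by rewrite in_setU1 in_setD (negPf xI) andbF orbF; apply: contraNneq xI => ->; apply: tI.
    by rewrite mxE in_setI (negPf xI) andbF.
  rewrite mulmxDl mxE unitB ne andbT; case: ifP => yC; first by rewrite addrC subrK.
  rewrite addr0 BL // gE // in_setD yJ andbT; apply: contraFN yC => yI.
  by rewrite in_setI yJ.
- move=> x xI; rewrite mxE cv0 ?in_setD ?(negPf xI) ?andbF // add0r !mxE in_setI.
  by rewrite (negPf xI) andbF oppr0.
- move=> y yJ ne; rewrite mulmxBl mxE [X in _ + X]mxE unitB ne andbT BL //.
  rewrite wL; last by rewrite ltnW ?Jle.
  case: ifP => yC; first by rewrite subrr.
  have yY : y \in J :\: I by move: yC; rewrite in_setI in_setD yJ andbT => /negbT.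
  rewrite subr0; have [/andP[yk _]|yK] := type1_inY sigmaK sk kt ti yY; last exact: wK.
  exact: wlt.
rewrite mulmxBl mxE [X in _ + X]mxE unitB eqxx andbF subr0 Bt // => eE.
by exists c, e.
Qed.
End Type1.
End OrbitMinors.

(** * Orbit points with prescribed free coordinates *)

Section FreeCoordinates.
Variables (R : comUnitRingType) (n : nat) (sigma : 'S_n) (f : 'I_n -> R).
Hypothesis sigmaK : involutive sigma.
Hypothesis f_unit : forall j : 'I_n, (j < sigma j)%N -> f j \is a GRing.unit.

(* eps_t - eps_i lies in the union of M and S. *)
Definition constrained (t i : 'I_n) : bool :=
  (i == sigma t) || (sigma t < (if (sigma i <= t)%N then sigma i else i))%N.

(** Keeps the arcs starting at [p] or later. The indices [act p] are those whose whole sigma-orbit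
    is at least [p]; [u] and [v] are kept trivial on the others. *)
Let Fge (p : nat) : 'M[R]_n :=
  \matrix_(x, y) if (p <= y)%N then involution_mx sigma f x y else 0.
Let act (p : nat) (x : 'I_n) := (p <= x)%N && (p <= sigma x)%N.

Lemma add1_transvection_uni (X : 'M[R]_n) :
  (forall i j : 'I_n, (j <= i)%N -> X i j = 0) ->
  upper_unitri (1%:M + X) /\ upper_unitri (1%:M - X).
Proof.
by move=> X0; split=> i j le; rewrite !mxE ?X0 // ?oppr0 addr0.
Qed.

Lemma sqr0_inverse (X : 'M[R]_n) : X *m X = 0 ->
  (1%:M + X) *m (1%:M - X) = 1%:M /\ (1%:M - X) *m (1%:M + X) = 1%:M.
Proof.
move=> X2; rewrite mulmxDl mul1mx mulmxBr mulmx1 X2 subr0 subrK.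
by rewrite mulmxBl mul1mx mulmxDr mulmx1 X2 addr0 addrK.
Qed.

Lemma Fge0 p i y : Fge p i y != 0 -> [/\ y = sigma i, act p y & act p i].
Proof.
rewrite !mxE; case: ifP => [py|_]; last by rewrite eqxx.
case: ifP => [/andP[lt /eqP iE] _|]; last by rewrite eqxx.
by rewrite /act iE sigmaK py (leq_trans py) // -iE ltnW.
Qed.

(** Descending induction on [p], adding the arc from [a = p] to [m = sigma a]. The new free
    positions lie in column [a] and row [m]; the factors built from [X] and [Y] fill them using the
    unit [f a]. They change the other free positions by [alpha i * beta j], which is subtracted in
    advance from the target given to the induction hypothesis. *)
Lemma free_coords_surj_ge (p : nat) (tgt : 'M[R]_n) : (p <= n)%N ->
  exists u v : 'M[R]_n, [/\ upper_unitri u /\ upper_unitri v,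
    u *m v = 1%:M /\ v *m u = 1%:M,
    forall i j, ~~ (act p i && act p j) -> u i j = (i == j)%:R,
    forall i j, ~~ (act p i && act p j) -> v i j = (i == j)%:R &
    forall t i : 'I_n, act p t -> act p i -> (t < i)%N -> ~~ constrained t i ->
      (u *m Fge p *m v) i t = tgt i t].
Proof.
move/subnK; move: (n - p)%N => d; elim: d p tgt => [|d IH] p tgt pE.
  exists 1%:M, 1%:M; split; rewrite ?mul1mx //; try by move=> i j _; rewrite mxE.
    by split; apply: upper_unitri1.
  by move=> t i /andP[pt _]; have := ltn_ord t; lia.
have ltpn : (p < n)%N by rewrite -pE addSn ltnS leq_addl.
pose a := Ordinal ltpn; pose m := sigma a.
have sm : sigma m = a by apply: sigmaK.
have actS x : act p x = act p.+1 x || ((x == a) || (x == m)) && (p <= m)%N.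
  rewrite /act; case: (eqVneq x a) => [->|xa]; first by rewrite -/m /=; lia.
  case: (eqVneq x m) => [->|xm]; first by rewrite sm /=; lia.
  have nx : (x : nat) <> p by move=> e; case/eqP: xa; apply: val_inj.
  have nsx : (sigma x : nat) <> p.
    by move=> e; case/eqP: xm; rewrite /m -[x]sigmaK; congr (sigma _); apply: val_inj.
  by rewrite /=; lia.
have pE1 : (d + p.+1)%N = n by rewrite addnS -addSn.
have act_p1 x : act p.+1 x -> act p x by rewrite actS => ->.
have mono i j : ~~ (act p i && act p j) -> ~~ (act p.+1 i && act p.+1 j).
  by apply: contraNN => /andP[/act_p1-> /act_p1].
have [le_ma|lt_am] := leqP m a.
  (* No arc starts at [a]. If [m < a], then [a] is not active; if [m = a], every active position
     below the diagonal in column [a] is constrained. *)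
  have FE : Fge p = Fge p.+1.
    apply/matrixP=> x y; rewrite !mxE; case: (ltngtP p y) => // py.
    have -> : y = a by apply: val_inj.
    rewrite -/m; case: eqP => [->|]; last by rewrite andbF.
    by rewrite ltnNge le_ma.
  have [u [v [uvU uv uA vA uvE]]] := IH p.+1 tgt pE1.
  exists u, v; split=> // [i j /mono|i j /mono|t i]; [exact: uA|exact: vA|].
  rewrite FE => pt pi lt; have pti : (p < i)%N.
    by move: pt => /andP[pt _]; apply: leq_ltn_trans lt.
  have [ta|nta] := eqVneq t a.
    have ma : m = a by apply/val_inj/eqP; rewrite eqn_leq le_ma; move: pt; rewrite ta => /andP[].
    have si : sigma i <> a :> nat.
      by move=> /val_inj si; move: pti; rewrite -[i]sigmaK si -/m ma ltnn.
    have lt1 : (a < sigma i)%N.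
      by rewrite ltn_neqAle eq_sym; apply/andP; split; [apply/eqP | case/andP: pi].
    by rewrite /constrained ta -/m ma [(sigma i <= a)%N]leqNgt lt1 /= pti orbT.
  have ni : i != a by apply: contraTneq pti => ->; rewrite ltnn.
  have sub x : x != a -> act p x -> act p.+1 x.
    move=> nxa; rewrite actS (negPf nxa) /= => /orP[//|/andP[/eqP xm pm]].
    have ma : m = a by apply/val_inj/eqP; rewrite eqn_leq le_ma.
    by move: nxa; rewrite xm ma eqxx.
  by apply: uvE => //; apply: sub.
have fU : f a \is a GRing.unit by apply: f_unit.
have nam : a != m by apply: contraTneq lt_am => <-; rewrite ltnn.
have act_a : act p.+1 a = false by rewrite /act ltnn.
have act_m : act p.+1 m = false by rewrite /act sm ltnn andbF.
have actE x : act p x = [|| act p.+1 x, x == a | x == m].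
  by rewrite actS (ltnW lt_am) andbT.
(* The bound [i < m] keeps [1 + X] upper unitriangular and loses nothing: in column [a] the active
   positions from row [m] on are constrained. *)
pose alpha i := if act p.+1 i && (i < m)%N then tgt i a / f a else 0.
pose beta j := if act p.+1 j && (j < m)%N then tgt m j else 0.
have alpha0 i : ~~ act p.+1 i -> alpha i = 0 by rewrite /alpha => /negPf->.
have beta0 j : ~~ act p.+1 j -> beta j = 0 by rewrite /beta => /negPf->.
pose X : 'M[R]_n := \matrix_(i, j) if j == m then alpha i else 0.
pose Y : 'M[R]_n := \matrix_(i, j) if i == a then beta j / f a else 0.
have XM M i j : (X *m M) i j = alpha i * M m j.
  rewrite mxE (bigD1 m) //= big1 ?addr0 => [|b /negPf nb]; first by rewrite mxE eqxx.
  by rewrite mxE nb mul0r.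
have MX M i j : j != m -> (M *m X) i j = 0.
  by move=> /negPf nj; rewrite mxE big1 // => b _; rewrite mxE nj mulr0.
have YM M i j : i != a -> (Y *m M) i j = 0.
  by move=> /negPf ni; rewrite mxE big1 // => b _; rewrite mxE ni mul0r.
have MY M i j : (M *m Y) i j = M i a * (beta j / f a).
  rewrite mxE (bigD1 a) //= big1 ?addr0 => [|b /negPf nb]; first by rewrite mxE eqxx.
  by rewrite mxE nb mulr0.
have XX : X *m X = 0.
  by apply/matrixP=> i j; rewrite XM !mxE (alpha0 m) ?act_m // if_same mulr0.
have YY : Y *m Y = 0.
  by apply/matrixP=> i j; rewrite MY !mxE (beta0 a) ?act_a // mul0r if_same mul0r.
have [X1 X2] : upper_unitri (1%:M + X) /\ upper_unitri (1%:M - X).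
  apply: add1_transvection_uni => i j le; rewrite mxE; case: eqP => // jm.
  by rewrite /alpha ltnNge -jm le andbF.
have [Y1 Y2] : upper_unitri (1%:M + Y) /\ upper_unitri (1%:M - Y).
  apply: add1_transvection_uni => i j le; rewrite mxE; case: eqP => // ia.
  rewrite beta0 ?mul0r // /act negb_and -leqNgt; apply/orP; left.
  by rewrite (leq_trans le) ?ia.
have [XV VX] := sqr0_inverse XX; have [YV VY] := sqr0_inverse YY.
pose tgt' : 'M[R]_n := \matrix_(i, j) (tgt i j - alpha i * beta j).
have [u [v [[uU vU] [uv vu] uA vA uvE]]] := IH p.+1 tgt' pE1.
pose M := u *m Fge p *m v.
pose G := u *m Fge p.+1 *m v.
have FE i j : Fge p i j = Fge p.+1 i j + (if (i == m) && (j == a) then f a else 0).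
  rewrite !mxE; case: (ltngtP p j) => pj.
  - by case: (eqVneq j a) pj => [->|_ _]; rewrite ?ltnn // andbF addr0.
  - by case: (eqVneq j a) pj => [->|_ _]; rewrite ?ltnn // andbF addr0.
  have -> : j = a by apply: val_inj.
  by rewrite eqxx andbT add0r -/m; case: eqP => [->|_]; rewrite ?lt_am ?andbT ?andbF.
have G0 i j : ~~ (act p.+1 i && act p.+1 j) -> G i j = 0.
  rewrite negb_and => /orP[nA|nA].
    rewrite /G -mulmxA mxE (bigD1 i) //= [X in _ + X]big1 ?addr0 => [|b nb].
      rewrite [X in _ * X]mxE big1 ?mulr0 // => y _.
      case: (eqVneq (Fge p.+1 i y) 0) => [->|/Fge0[_ _ ai]]; first by rewrite mul0r.
      by rewrite ai in nA.
    by rewrite uA 1?eq_sym ?(negPf nA) // (negPf nb) mul0r.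
  rewrite /G mxE (bigD1 j) //= [X in _ + X]big1 ?addr0 => [|b nb].
    rewrite [X in X * _]mxE big1 ?mul0r // => y _.
    case: (eqVneq (Fge p.+1 y j) 0) => [->|/Fge0[_ aj _]]; first by rewrite mulr0.
    by rewrite aj in nA.
  by rewrite vA ?(negPf nA) ?andbF // (negPf nb) mulr0.
have ME i j : M i j = G i j + (if (i == m) && (j == a) then f a else 0).
  have -> : M = G + u *m (f a *: delta_mx m a) *m v.
    rewrite -mulmxDl -mulmxDr; congr (_ *m _ *m _); apply/matrixP=> x y.
    rewrite FE [in RHS]mxE; congr (_ + _); rewrite !mxE.
    by case: ((x == m) && (y == a)); rewrite ?mulr1 ?mulr0.
  rewrite mxE; congr (_ + _); rewrite -scalemxAr -scalemxAl mxE.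
  rewrite mxE (bigD1 a) //= big1 ?addr0 => [|b /negPf nb]; last first.
    rewrite mxE big1 ?mul0r // => y _; rewrite mxE nb andbF mulr0 //.
  rewrite vA ?act_a // mxE (bigD1 m) //= big1 ?addr0 => [|b /negPf nb]; last first.
    by rewrite mxE nb mulr0.
  rewrite uA ?act_m ?andbF // mxE !eqxx mulr1 [a == j]eq_sym.
  by case: (i == m); case: (j == a); rewrite /= ?mulr1 ?mulr0 ?mul0r.
exists ((1%:M + X) *m ((1%:M - Y) *m u)), ((v *m (1%:M + Y)) *m (1%:M - X)).
have YuE i j : ((1%:M - Y) *m u) i j =
    u i j - (if i == a then \sum_b beta b / f a * u b j else 0).
  rewrite mulmxBl mul1mx mxE [X in _ + X]mxE; congr (_ - _).
  rewrite mxE; case: ifP => ia; last by rewrite big1 // => b _; rewrite mxE ia mul0r.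
  by apply: eq_bigr => b _; rewrite mxE ia.
have vYE i j : (v *m (1%:M + Y)) i j = v i j + v i a * (beta j / f a).
  by rewrite mulmxDr mulmx1 mxE MY.
have nact x : ~~ act p x -> [/\ ~~ act p.+1 x, x != a & x != m].
  by rewrite actE !negb_or => /and3P[].
split.
- by split; do !apply: upper_unitriM.
- split.
    rewrite !mulmxA -[_ *m u *m v]mulmxA uv mulmx1 -[_ *m (1%:M - Y) *m _]mulmxA.
    by rewrite VY mulmx1.
  rewrite !mulmxA -[_ *m (1%:M - X) *m _]mulmxA VX mulmx1.
  by rewrite -[_ *m (1%:M + Y) *m _]mulmxA YV mulmx1 vu.
- move=> i j ij; rewrite mulmxDl mul1mx mxE XM !YuE.
  rewrite [m == a]eq_sym (negPf nam) subr0 (uA m j) ?act_m //.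
  move: ij; rewrite negb_and => /orP[/nact[nA na nm]|/nact[nA na nm]].
    by rewrite uA ?(negPf nA) // (negPf na) subr0 alpha0 // mul0r addr0.
  rewrite [m == j]eq_sym (negPf nm) mulr0 addr0 uA ?(negPf nA) ?andbF //.
  rewrite [X in if _ then X else _]big1 ?if_same ?subr0 // => b _.
  rewrite uA ?(negPf nA) ?andbF //; case: eqP => [->|_]; rewrite ?mulr0 //.
  by rewrite beta0 // !mul0r.
- move=> i j ij; rewrite mulmxBr mulmx1 mxE [X in _ + X]mxE vYE.
  move: ij; rewrite negb_and => /orP[/nact[nA na nm]|/nact[nA na nm]]; last first.
    by rewrite MX // oppr0 addr0 vA ?(negPf nA) ?andbF // beta0 // mul0r mulr0 addr0.
  rewrite vA ?(negPf nA) // vA ?(negPf nA) // (negPf na) mul0r addr0.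
  rewrite mxE big1 ?oppr0 ?addr0 // => b _; rewrite vYE !mxE.
  rewrite !vA ?(negPf nA) // (negPf na) mul0r addr0; case: eqP => [<-|_].
    by rewrite alpha0 // if_same mulr0.
  by rewrite mul0r.
move=> t i pt pi ti nc.
(* Active positions below the diagonal in column [m] are constrained, because [sigma m = a] is the
   least index in play. *)
have ntm : t != m.
  apply: contraNneq nc => tm; rewrite /constrained tm sm.
  have nia : i != a.
    by apply: contraTneq ti => ->; rewrite -leqNgt tm ltnW.
  have nim : i != m by apply: contraTneq ti => ->; rewrite tm ltnn.
  move: pi; rewrite actE (negPf nia) (negPf nim) /= orbF /act => /andP[h1 h2].
  by case: ifP.
have nia : i != a.
  apply: contraTneq ti => ->; rewrite -leqNgt /=; by case/andP: pt.
have WE : ((1%:M + X) *m ((1%:M - Y) *m u) *m Fge p *m (v *m (1%:M + Y) *m (1%:M - X))) i t =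
    M i t + M i a * (beta t / f a) + alpha i * (M m t + M m a * (beta t / f a)).
  have -> : (1%:M + X) *m ((1%:M - Y) *m u) *m Fge p *m (v *m (1%:M + Y) *m (1%:M - X)) =
      (1%:M + X) *m ((1%:M - Y) *m (M *m (1%:M + Y))) *m (1%:M - X).
    by rewrite /M !mulmxA.
  rewrite mulmxBr mulmx1 mxE [X in _ + X]mxE MX // oppr0 addr0.
  rewrite mulmxDl mul1mx mxE XM mulmxBl mul1mx.
  have E j : j != a -> (M *m (1%:M + Y) - Y *m (M *m (1%:M + Y))) j t =
      M j t + M j a * (beta t / f a).
    by move=> ne; rewrite mxE [X in _ + X]mxE YM // oppr0 addr0 mulmxDr mulmx1 mxE MY.
  by rewrite !E // eq_sym.
have gt_a j : act p.+1 j -> (a < j)%N by case/andP.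
have fm0 : M m a = f a by rewrite ME G0 ?act_a ?andbF // !eqxx add0r.
have Mia : i != m -> M i a = 0.
  by move=> /negPf nim; rewrite ME G0 ?act_a ?andbF // nim add0r.
have Mmt : t != a -> M m t = 0.
  by move=> /negPf nta; rewrite ME G0 ?act_m // nta andbF add0r.
have fb : f a * (beta t / f a) = beta t by rewrite mulrCA divrr // mulr1.
rewrite WE fm0 fb.
case: (eqVneq i m) => [im|nim].
  have nta : t != a by apply: contraNneq nc => ta; rewrite /constrained ta im -/m eqxx.
  have t1 : act p.+1 t by move: pt; rewrite actE (negPf nta) (negPf ntm) !orbF.
  by rewrite im fm0 alpha0 ?act_m // mul0r addr0 Mmt // add0r fb /beta t1 -im ti.
have i1 : act p.+1 i by move: pi; rewrite actE (negPf nia) (negPf nim) !orbF.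
rewrite Mia // mul0r addr0; case: (eqVneq t a) => [ta|nta].
  rewrite ta fm0 ME G0 ?act_a ?andbF // (negPf nim) add0r add0r.
  rewrite (beta0 a) ?act_a // addr0 /alpha i1 /=.
  have lim : (i < m)%N.
    rewrite ltnNge; apply: contraNN nc => le; rewrite /constrained ta -/m (negPf nim) /=.
    rewrite [(sigma i <= a)%N]leqNgt; case/andP: i1 => [_ ->] /=.
    by rewrite ltn_neqAle le andbT eq_sym.
  by rewrite lim divrK.
have t1 : act p.+1 t by move: pt; rewrite actE (negPf nta) (negPf ntm) !orbF.
rewrite Mmt // add0r ME (negPf nim) /= addr0 /G uvE // mxE.
by rewrite subrK.
Qed.

Lemma free_coords_surj (tgt : 'M[R]_n) : exists u v : 'M[R]_n,
  [/\ upper_unitri u /\ upper_unitri v, u *m v = 1%:M /\ v *m u = 1%:M &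
    forall t i : 'I_n, (t < i)%N -> ~~ constrained t i ->
      (u *m involution_mx sigma f *m v) i t = tgt i t].
Proof.
have [u [v [uvU uvI _ _ uvE]]] := @free_coords_surj_ge 0 tgt (leq0n n).
exists u, v; split=> // t i lt nc; rewrite -uvE //; congr ((_ *m _ *m _) i t).
by apply/matrixP=> x y; rewrite !mxE.
Qed.
End FreeCoordinates.

(** * Roots and reflections *)

Section ReflectionDecomposition.
Variables (n : nat) (sigma : 'S_n) (xi : seq (posroot n)).
Hypothesis sigmaK : involutive sigma.
Hypothesis xiP : refl_decomp sigma xi.

Lemma jr_lt_ir (g : posroot n) : (jr g < ir g)%N. Proof. exact: (valP g). Qed.

Lemma posroot_inj (g h : posroot n) : jr g = jr h -> ir g = ir h -> g = h.
Proof.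
move=> ej ei; apply: val_inj; rewrite [val g]surjective_pairing.
by rewrite [val h]surjective_pairing -/(jr g) -/(ir g) ej ei.
Qed.

(** If [refl y] moved [jr x] to a point other than [ir x], that point would be fixed by [refl x],
    and commutation would give [refl y] the same value at [jr x] and [ir x]. Exchanging the two
    would force [y = x]. *)
Lemma refl_decomp_disjoint x y : x \in xi -> y \in xi -> y != x ->
  [/\ refl y (jr x) = jr x & refl y (ir x) = ir x].
Proof.
move=> xxi yxi ne; case: xiP => _ /(_ x y xxi yxi) xy _.
have xyE a : refl y (refl x a) = refl x (refl y a) by rewrite -!permM xy.
have ltx := jr_lt_ir x; have lty := jr_lt_ir y.
have swap : refl y (jr x) = ir x -> False.
  rewrite /refl; case: tpermP => [ex ey|ex ey|_ _ e].
  - by case/eqP: ne; apply: posroot_inj; rewrite ?ex ?ey.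
  - by move: ltx; rewrite ex -ey ltnNge (ltnW lty).
  - by move: ltx; rewrite e ltnn.
have reflj : refl x (jr x) = ir x by rewrite /refl tpermL.
have refli : refl x (ir x) = jr x by rewrite /refl tpermR.
have fixj : refl y (jr x) = jr x.
  apply/eqP; apply: contraT => nj.
  have e : refl x (refl y (jr x)) = refl y (jr x).
    rewrite {1}/refl tpermD //; first by rewrite eq_sym.
    by apply/eqP=> /esym /swap.
  have /perm_inj ij : refl y (ir x) = refl y (jr x) by rewrite -reflj xyE e.
  by move: ltx; rewrite ij ltnn.
by split=> //; apply: (@perm_inj _ (refl x)); rewrite refli -xyE refli fixj.
Qed.

Lemma prod_refl_notin (s : seq (posroot n)) a :
    {in s, forall y, refl y a = a} -> (\prod_(y <- s) refl y)%g a = a.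
Proof.
elim: s => [_|y s IH sa]; first by rewrite big_nil perm1.
rewrite big_cons permM sa ?mem_head // IH // => z zs.
by apply: sa; rewrite inE zs orbT.
Qed.

Lemma prod_refl_in (s : seq (posroot n)) x : {subset s <= xi} -> uniq s -> x \in s ->
  (\prod_(y <- s) refl y)%g (jr x) = ir x /\ (\prod_(y <- s) refl y)%g (ir x) = jr x.
Proof.
elim: s => [//|y s IH] sub /= /andP[ys us]; rewrite inE !big_cons !permM.
have [yxi subs] : y \in xi /\ {subset s <= xi}.
  by split=> [|z zs]; apply: sub; rewrite inE ?eqxx ?zs ?orbT.
have [-> _|nxy /= xs] := eqVneq x y.
  have nzy z : z \in s -> z != y by move=> zs; apply: contraNneq ys => <-.
  rewrite /refl tpermL tpermR !prod_refl_notin // => z zs;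
  by have [] := refl_decomp_disjoint yxi (subs z zs) (nzy z zs).
have nyx : y != x by rewrite eq_sym.
by have [-> ->] := refl_decomp_disjoint (subs x xs) yxi nyx; apply: IH.
Qed.

Lemma refl_decomp_uniq : uniq xi.
Proof.
case: xiP => srt _ _; apply: sorted_uniq srt => [y x z|x]; first exact: ltn_trans.
exact: ltnn.
Qed.

(** Makes [sigma] alone responsible for everything that follows: [xi] is the list of its arcs. *)
Lemma refl_decomp_mem g : (g \in xi) = (ir g == sigma (jr g)).
Proof.
have [_ _ sE] := xiP; have mem x := @prod_refl_in xi x (fun _ h => h) refl_decomp_uniq.
apply/idP/eqP => [/mem[]|eg]; first by rewrite -sE => ->.
have lt := jr_lt_ir g; apply: contraTT lt => gxi.
have [hx|nx] := boolP (has (fun x => (jr g == jr x) || (jr g == ir x)) xi).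
  have /hasP[x xxi /orP[/eqP ej|/eqP ej]] := hx; have [j1 i1] := mem x xxi.
    by case/negP: gxi; rewrite (@posroot_inj g x) // eg ej sE j1.
  by rewrite eg ej sE i1 -leqNgt ltnW // jr_lt_ir.
rewrite eg sE prod_refl_notin ?ltnn // => y yxi.
move/hasPn: nx => /(_ y yxi); rewrite negb_or /refl => /andP[n1 n2].
by rewrite tpermD // eq_sym.
Qed.

Lemma sigma_uptoE (m : nat) (a : 'I_n) :
  sigma_upto xi m a = if (minn a (sigma a) < m)%N then sigma a else a.
Proof.
have [_ _ sE] := xiP.
have mem x := @prod_refl_in xi x (fun _ h => h) refl_decomp_uniq.
rewrite /sigma_upto -big_filter; set s := [seq _ <- _ | _].
have sub : {subset s <= xi} by move=> z; rewrite mem_filter => /andP[].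
have us : uniq s by rewrite filter_uniq // refl_decomp_uniq.
have [hx|nx] := boolP (has (fun x => (a == jr x) || (a == ir x)) xi); last first.
  have fixa y : y \in xi -> refl y a = a.
    move=> yxi; move/hasPn: nx => /(_ y yxi); rewrite negb_or /refl => /andP[n1 n2].
    by rewrite tpermD // eq_sym.
  rewrite prod_refl_notin => [|y /sub]; last exact: fixa.
  by rewrite {2}sE prod_refl_notin ?if_same.
have /hasP[x xxi ax] := hx; have [j1 i1] := mem x xxi; rewrite -sE in j1 i1.
have ltx := jr_lt_ir x.
have -> : minn a (sigma a) = jr x.
  case/orP: ax => /eqP ->; rewrite ?j1 ?i1; [exact/minn_idPl/ltnW|exact/minn_idPr/ltnW].
case: ltnP => lt.
  have xs : x \in s by rewrite mem_filter lt.
  have [j2 i2] := prod_refl_in sub us xs.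
  by case/orP: ax => /eqP ->; rewrite ?j1 ?i1.
rewrite prod_refl_notin // => y ys; have yxi := sub y ys.
have nyx : y != x by apply: contraTneq ys => ->; rewrite mem_filter ltnNge lt.
by have [] := refl_decomp_disjoint xxi yxi nyx; case/orP: ax => /eqP ->.
Qed.

(** The bound [(jr g).+1] includes an arc starting at [jr g] itself, so [jr g] always goes to its
    image under [sigma], whereas [ir g] moves only if its partner is at most [jr g]. *)
Lemma MsetE g : (g \in Mset xi) =
  (sigma (jr g) < (if (sigma (ir g) <= jr g)%N then sigma (ir g) else ir g))%N.
Proof.
rewrite inE /root_pos /root_act /= -/(jr g) -/(ir g) !sigma_uptoE.
have lt := jr_lt_ir g; rewrite [(minn (jr g) _ < _)%N](_ : _ = true); last by lia.
by congr (_ < nat_of_ord (if _ then _ else _))%N; lia.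
Qed.

Lemma type0E g : type0 xi g = (jr g <= sigma (ir g))%N.
Proof.
rewrite /type0 leqNgt; congr (~~ _); apply/hasP/idP => [[x xxi /andP[lt /eqP e]]|lt].
  by move: xxi; rewrite refl_decomp_mem => /eqP ex; rewrite -e ex sigmaK.
have lt' : (sigma (ir g) < ir g)%N := ltn_trans lt (jr_lt_ir g).
exists (exist _ (sigma (ir g), ir g) lt').
  by rewrite refl_decomp_mem /jr /ir /= sigmaK.
by rewrite /jr /ir /= eqxx andbT.
Qed.

Lemma Qpol_index g : sigma_upto xi (jr g) (ir g) =
  if (jr g <= sigma (ir g))%N then ir g else sigma (ir g).
Proof.
rewrite sigma_uptoE; have lt := jr_lt_ir g.
by rewrite [(minn _ _ < _)%N](_ : _ = ~~ (jr g <= sigma (ir g))%N) ?if_neg //; lia.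
Qed.
End ReflectionDecomposition.

(** * Ideals and polynomials *)

Section GeneratedIdeal.
Variables (R : comPzRingType) (G : R -> Prop).
Let I := generated_ideal G.

Lemma generated_ideal_gen q : G q -> I q.
Proof.
move=> Gq; exists [:: (1, q)]; last by rewrite big_seq1 mul1r.
by move=> cg; rewrite inE => /eqP->.
Qed.

Lemma generated_ideal0 : I 0.
Proof. by exists [::] => //; rewrite big_nil. Qed.

Lemma generated_idealD p q : I p -> I q -> I (p + q).
Proof.
move=> [s sG ->] [s' sG' ->]; exists (s ++ s'); last by rewrite big_cat.
by move=> cg; rewrite mem_cat => /orP[/sG|/sG'].
Qed.

Lemma generated_idealMl c p : I p -> I (c * p).
Proof.
move=> [s sG ->]; exists [seq (c * cg.1, cg.2) | cg <- s].
  by move=> _ /mapP[cg /sG Gcg ->].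
by rewrite big_map mulr_sumr; apply: eq_bigr => cg _ /=; rewrite mulrA.
Qed.

Lemma generated_idealN p : I p -> I (- p).
Proof. by rewrite -mulN1r; apply: generated_idealMl. Qed.

Lemma generated_idealB p q : I p -> I q -> I (p - q).
Proof. by move=> Ip Iq; apply: generated_idealD => //; apply: generated_idealN. Qed.

Lemma generated_ideal_sum (T : Type) (s : seq T) (P : pred T) (F : T -> R) :
  (forall i, P i -> I (F i)) -> I (\sum_(i <- s | P i) F i).
Proof.
move=> IF; apply: (big_ind I) => //; [exact: generated_ideal0|exact: generated_idealD].
Qed.

Lemma generated_ideal_congM a b a' b' : I (a - a') -> I (b - b') -> I (a * b - a' * b').
Proof.
move=> Ia Ib; have -> : a * b - a' * b' = b * (a - a') + a' * (b - b').
  by rewrite !mulrBr [b * a]mulrC [b * a']mulrC addrA subrK.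
by apply: generated_idealD; apply: generated_idealMl.
Qed.
End GeneratedIdeal.

Lemma comp_mpoly_cong (K : comNzRingType) (N k : nat) (G : {mpoly K[k]} -> Prop)
    (lq lq' : N.-tuple {mpoly K[k]}) (p : {mpoly K[N]}) :
  (forall i, generated_ideal G (tnth lq i - tnth lq' i)) ->
  generated_ideal G ((p \mPo lq) - (p \mPo lq')).
Proof.
move=> Ilq; rewrite !comp_mpolyEX -sumrB; apply: generated_ideal_sum => m _.
rewrite -scalerBr -mul_mpolyC; apply: generated_idealMl.
rewrite !comp_mpolyX.
apply: (big_ind2 (fun a b => generated_ideal G (a - b))).
- by rewrite subrr; apply: generated_ideal0.
- by move=> *; apply: generated_ideal_congM.
move=> i _; elim: (m i) => [|d IH]; first by rewrite !expr0 subrr; apply: generated_ideal0.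
by rewrite !exprS; apply: generated_ideal_congM.
Qed.

(** Induction on the number of variables, the last one being split off by [muni]. With the others
    evaluated, the remaining univariate polynomial vanishes at all natural numbers, which are
    distinct in characteristic zero. *)
Lemma mpoly_meval_eq0 (K : fieldType) (charK : [pchar K] =i pred0) (N : nat)
  (p : {mpoly K[N]}) : (forall v, p.@[v] = 0) -> p = 0.
Proof.
have natr_inj : injective (fun m : nat => m%:R : K).
  move=> a b; wlog le : a b / (a <= b)%N => [hw|] /= e.
    by case/orP: (leq_total a b) => le; [|symmetry]; apply: hw.
  apply/eqP; rewrite eqn_leq le -subn_eq0.
  by rewrite -((pcharf0P K).1 charK) natrB // e subrr eqxx.
elim: N p => [p p0|N IH p p0].
  by have := p0 (fun _ => 0); rewrite [p]nvar0_mpolyC mevalC => ->; rewrite mpolyC0.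
have muni_p0 : muni p = 0.
  apply/polyP=> d; rewrite coef0; apply: IH => v'.
  rewrite -[LHS](coef_map (meval v')); set P := map_poly _ _.
  suff -> : P = 0 by rewrite coef0.
  apply: (@roots_geq_poly_eq0 _ _ [seq i%:R | i <- iota 0 (size P)]).
  - apply/allP=> x _; rewrite /root /P.
    pose v (i : 'I_N.+1) := if insub (i : nat) is Some j then v' j else x.
    rewrite -(p0 v) mevalE muniE raddf_sum /= horner_sum; apply/eqP/eq_bigr => m _.
    rewrite map_polyZ map_polyXn hornerZ hornerXn /= mevalZ mevalX big_ord_recr mulrA /=.
    congr (_ * _ * _ ^+ _); last by rewrite /v insubN // ltnn.
    by apply: eq_bigr => i _; rewrite mnmE /v valK.
  - by rewrite map_inj_uniq ?iota_uniq.
  - by rewrite size_map size_iota.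
(* It remains to read the coefficient of [m0] off [muni p]: the exponent of the last variable
   selects a coefficient of the univariate polynomial, the other exponents a coefficient of that. *)
apply/mpolyP=> m0; rewrite mcoeff0.
have := congr1 (fun q : {poly {mpoly K[N]}} => (q`_(m0 ord_max))@_[multinom m0 (widen_ord (leqnSn N) i) | i < N]) muni_p0.
rewrite muniE coef_sum coef0 mcoeff0 raddf_sum /= => <-.
rewrite [in LHS](mpolyE p) raddf_sum /=; apply: eq_bigr => m _.
rewrite coefZ coefXn mulr_natr mcoeffZ mcoeffX.
rewrite raddfMn /= mcoeffZ mcoeffX.
have -> : (m == m0) = ([multinom m (widen_ord (leqnSn N) i) | i < N] ==
    [multinom m0 (widen_ord (leqnSn N) i) | i < N]) && (m0 ord_max == m ord_max).
  apply/eqP/andP => [->//|[/eqP e1 /eqP e2]]; apply/mnmP=> i.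
  have [j ->|->] := unliftP ord_max i; last by [].
  have := congr1 (fun q : 'X_{1..N} => q j) e1; rewrite !mnmE.
  by rewrite (_ : widen_ord _ j = lift ord_max j) //; apply/val_inj/esym/lift_max.
case: eqP => _ /=; last by rewrite mulr0 mul0rn.
by rewrite mulr1 mulr_natr.
Qed.

(** * Coordinates on the dual and evaluation of the generators *)

Section DualMatrix.
Variables (K : fieldType) (n : nat).

Lemma Phi_gt (g : posroot n) : Phi K n (ir g) (jr g) = yvar K g.
Proof.
rewrite PhiE; case: insubP => [h _ valh|]; last by rewrite /root_pos /= jr_lt_ir.
by congr yvar; apply: val_inj; rewrite valh -surjective_pairing.
Qed.

Lemma Phi_le (i j : 'I_n) : (i <= j)%N -> Phi K n i j = 0.
Proof. by move=> le; rewrite PhiE insubF // /root_pos /= ltnNge le. Qed.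

Lemma posrootW (i j : 'I_n) : (j < i)%N -> exists g : posroot n, jr g = j /\ ir g = i.
Proof. by move=> lt; exists (exist _ (j, i) lt). Qed.

(** Defined as a specialisation of [Phi], so that evaluating a generator at [h] is an instance of
    applying a ring morphism to [Phi]. *)
Definition dual_mx (h : ut_dual K n) : 'M[K]_n :=
  map_mx (meval (fun a => h (ybase K (enum_val a)))) (Phi K n).

Lemma dual_mx_gt h (g : posroot n) : dual_mx h (ir g) (jr g) = h (ybase K g).
Proof. by rewrite mxE Phi_gt mevalXU enum_rankK. Qed.

Lemma dual_mx_le h (i j : 'I_n) : (i <= j)%N -> dual_mx h i j = 0.
Proof. by move=> le; rewrite mxE Phi_le ?meval0. Qed.

Lemma dual_mxE (h : ut_dual K n) (x : subvs_of (ut K n)) :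
  h x = \sum_i \sum_j val x i j * dual_mx h i j.
Proof.
pose E (i j : 'I_n) : subvs_of (ut K n) := vsproj (ut K n) (if (j < i)%N then delta_mx i j else 0).
have EE (i j : 'I_n) : h (E i j) = dual_mx h i j.
  have [le|lt] := leqP i j; first by rewrite dual_mx_le // /E ltnNge le linear0 linear0.
  have [g [ej ei]] := posrootW lt; rewrite -ei -ej dual_mx_gt /E jr_lt_ir.
  by [].
have vE (i j : 'I_n) : val (E i j) = if (j < i)%N then delta_mx i j else 0.
  rewrite /E; have [le|lt] := leqP i j; first by rewrite linear0.
  have [g [ej ei]] := posrootW lt; rewrite -ei -ej.
  exact: val_ybase.
have /memv_utP x0 := subvsP x.
have {1}-> : x = \sum_i \sum_j val x i j *: E i j.
  apply: val_inj; rewrite raddf_sum {1}[val x]matrix_sum_delta /=.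
  apply: eq_bigr => i _; rewrite raddf_sum /=; apply: eq_bigr => j _.
  rewrite [X in _ = _ *: X]vE.
  by case: ltnP => // le; rewrite x0 // !scale0r.
rewrite linear_sum; apply: eq_bigr => i _; rewrite linear_sum; apply: eq_bigr => j _.
by rewrite linearZ /= EE.
Qed.

(** The pairing in [dual_mxE] is an entrywise sum, so conjugating the argument multiplies the matrix
    by transposes; entries on or above the diagonal are not seen by functionals on [ut]. *)
Lemma dual_mx_coAd (g : 'M[K]_n) (h : ut_dual K n) : UT g ->
  dual_mx (coAd g h) = lower_part ((invmx g)^T *m dual_mx h *m g^T).
Proof.
move=> UTg; apply/matrixP=> i j; rewrite [RHS]mxE; case: ltnP => [lt|]; last exact: dual_mx_le.
have [r [ej ei]] := posrootW lt; rewrite -ei -ej dual_mx_gt comp_lfunE dual_mxE.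
rewrite val_Ad ?UT_inv // invmxK val_ybase [RHS]mxE.
rewrite exchange_big /=; apply: eq_bigr => b _; rewrite mxE mulr_suml.
apply: eq_bigr => a _; rewrite mulrAC; congr (_ * _); rewrite mxE.
rewrite (bigD1 (jr r)) //= big1 ?addr0 => [|c nc]; last first.
  by rewrite mxE big1 ?mul0r // => d _; rewrite mxE (negPf nc) andbF mulr0.
rewrite mxE (bigD1 (ir r)) //= big1 ?addr0 => [|d nd]; last first.
  by rewrite mxE (negPf nd) mulr0.
by rewrite !mxE !eqxx mulr1.
Qed.

Lemma upper_unitri_UT (v : 'M[K]_n) : upper_unitri v -> UT v^T.
Proof.
move=> vU; apply/andP; split; last by apply/forallP=> i; rewrite mxE vU ?eqxx.
apply/is_trig_mxP=> i j lt; rewrite mxE vU ?(ltnW lt) //.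
by case: eqP lt => [->|//]; rewrite ltnn.
Qed.

Lemma UT_upper_unitri (g : 'M[K]_n) : UT g -> upper_unitri g^T.
Proof.
case/andP=> /is_trig_mxP g0 /forallP g1 i j; rewrite leq_eqVlt => /orP[/eqP/val_inj ->|lt].
  by rewrite mxE eqxx (eqP (g1 i)).
by rewrite mxE g0 // eq_sym; case: eqP lt => [->|//]; rewrite ltnn.
Qed.
End DualMatrix.

Lemma dual_mx_Xsigma (K : fieldType) n (sigma : 'S_n) xi (f : ut_dual K n) :
    refl_decomp sigma xi -> Xsigma xi f ->
  let c j := dual_mx f (sigma j) j in
  dual_mx f = involution_mx sigma c /\
  forall j : 'I_n, (j < sigma j)%N -> c j \is a GRing.unit.
Proof.
move=> xiP [f1 f0] c; have mem := refl_decomp_mem xiP; split.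
  apply/matrixP=> i j; rewrite [RHS]mxE; case: ltnP => [lt|]; last exact: dual_mx_le.
  have [g [ej ei]] := posrootW lt; case: eqP => [->//|ne].
  by rewrite -ei -ej dual_mx_gt f0 // mem ei ej; apply/eqP.
move=> j lt; have [g [ej ei]] := posrootW lt; rewrite /c -ei -ej dual_mx_gt.
by rewrite unitfE f1 // mem ei ej.
Qed.

Section Substitution.
Variables (K : fieldType) (n : nat).

Definition subst_mx (A : 'M[Sut K n]_n) : #|{: posroot n}|.-tuple (Sut K n) :=
  [tuple A (ir (enum_val a)) (jr (enum_val a)) | a < #|{: posroot n}|].

Lemma map_subst_Phi (A : 'M[Sut K n]_n) :
  map_mx (comp_mpoly (subst_mx A)) (Phi K n) = lower_part A.
Proof.
apply/matrixP=> i j; rewrite !mxE; have [le|lt] := leqP i j.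
  by rewrite -PhiE Phi_le // comp_mpoly0.
have [g [ej ei]] := posrootW lt; rewrite -PhiE -ei -ej Phi_gt comp_mpolyXU.
by rewrite -tnth_nth tnth_mktuple enum_rankK.
Qed.
End Substitution.

(** * The generators as signed masked determinants *)

Section Generators.
Variables (K : fieldType) (n : nat) (sigma : 'S_n) (xi : seq (posroot n)).
Hypothesis sigmaK : involutive sigma.
Hypothesis xiP : refl_decomp sigma xi.

Definition theta0 (k t j : 'I_n) : 'I_n := if j == t then k else sigma j.

(** The pencil needs a bijection that is the identity on [Jset :&: Iset]. Off that set [sigma] works
    except at [sigma t], whose image [t] is already taken by the fixed point [t]; it is sent to
    [sigma k], the row left over because [k] is fixed. *)
Definition theta1 (k t j : 'I_n) : 'I_n :=
  if j \in Iset sigma k t then j else if j == sigma t then sigma k else sigma j.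

Lemma theta0_in k t : {in Jset sigma k t, forall j, theta0 k t j \in Iset sigma k t}.
Proof.
move=> j; rewrite mem_Jset mem_Iset // /theta0; case: eqVneq => [_ _|_ /=]; first by rewrite eqxx.
by rewrite sigmaK andbC => ->; rewrite orbT.
Qed.

Lemma theta0_inj k t : {in Jset sigma k t &, injective (theta0 k t)}.
Proof.
move=> i j; rewrite !mem_Jset /theta0.
case: (eqVneq i t) => [->|_]; case: (eqVneq j t) => [->|_] //= hi hj.
- by move=> e; move: hj; rewrite -e ltnn andbF.
- by move=> e; move: hi; rewrite e ltnn andbF.
by move/perm_inj.
Qed.

(** In type 0 the pencil therefore has no row carrying tau, and P_{k,t,0} is, up to sign, a minor of
    [Phi]. *)
Lemma disjoint_JI (k t : 'I_n) : (t < k)%N -> Jset sigma k t :&: Iset sigma k t = set0.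
Proof.
move=> tk; apply/setP=> j; rewrite in_setI mem_Jset mem_Iset // in_set0.
case: (eqVneq j t) => [->|_]; case: (eqVneq _ k) => [e|_] /=; rewrite ?e; try lia.
by move: tk; rewrite e ltnn.
Qed.

Lemma theta0_gt (k t : 'I_n) : (t < k)%N ->
  {in Jset sigma k t, forall j : 'I_n, (j < theta0 k t j)%N}.
Proof.
move=> tk j; rewrite mem_Jset /theta0; case: (eqVneq j t) => [->//|_] /andP[jt kj].
by rewrite (ltn_trans jt) // (ltn_trans tk).
Qed.

Section Theta1.
Variables k t : 'I_n.
Hypothesis sk : (sigma t < k)%N.
Hypothesis kt : (k < t)%N.
Hypothesis ti : (t < sigma k)%N.
Let I := Iset sigma k t.
Let J := Jset sigma k t.

Lemma theta1_NI j : j \in J -> j \notin I -> [/\ j != t, j != k & (k < sigma j)%N && (j < t)%N].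
Proof.
rewrite mem_Jset mem_Iset // negb_or => jJ /andP[nk nI]; split=> //.
  by apply: contraNneq nI => ->; rewrite kt (ltn_trans sk kt).
by case/predU1P: jJ nI => [->|/andP[-> ->]] //; rewrite kt (ltn_trans sk kt).
Qed.

Lemma theta1_in : {in J, forall j, theta1 k t j \in I}.
Proof.
move=> j jJ; rewrite /theta1 -/I; have [//|jI] := boolP (j \in I).
have [njt njk /andP[kj jt]] := theta1_NI jJ jI; case: eqP => _.
  by rewrite mem_Iset // sigmaK kt (ltn_trans kt ti) orbT.
by rewrite mem_Iset // sigmaK kj jt orbT.
Qed.

Lemma theta1_notinJ j : j \in J -> j \notin I -> theta1 k t j \notin J.
Proof.
move=> jJ jI; have [njt njk /andP[kj jt]] := theta1_NI jJ jI.
rewrite /theta1 (negPf jI); case: eqP => [_|/eqP ns].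
  rewrite mem_Jset sigmaK ltnn andbF orbF; apply: contraTneq ti => ->.
  by rewrite ltnn.
rewrite mem_Jset sigmaK negb_or; apply/andP; split.
  by apply: contraNneq ns => <-; rewrite sigmaK.
by apply: contraNN jI => /andP[st kj']; rewrite mem_Iset // st kj' orbT.
Qed.

Lemma theta1_id : {in J :&: I, forall j, theta1 k t j = j}.
Proof. by move=> j; rewrite in_setI /theta1 => /andP[_ ->]. Qed.

Lemma theta1_inj : {in J &, injective (theta1 k t)}.
Proof.
move=> i j iJ jJ; have [iI|iI] := boolP (i \in I); have [jI|jI] := boolP (j \in I).
- by rewrite !theta1_id // in_setI ?iJ ?jJ.
- move=> e; have := theta1_notinJ jJ jI.
  by rewrite -e theta1_id ?iJ // in_setI iJ.
- move=> e; have := theta1_notinJ iJ iI.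
  by rewrite e theta1_id ?jJ // in_setI jJ.
have [_ nik _] := theta1_NI iJ iI; have [_ njk _] := theta1_NI jJ jI.
rewrite /theta1 (negPf iI) (negPf jI).
case: eqP => [->|_]; case: eqP => [->|_] //; last exact: perm_inj.
- by move/perm_inj => e; rewrite -e eqxx in njk.
by move/perm_inj => e; rewrite e eqxx in nik.
Qed.

Lemma theta1_gt : {in J :\: I, forall j : 'I_n, (j < theta1 k t j)%N}.
Proof.
move=> j; rewrite in_setD => /andP[jI jJ]; have [_ njk /andP[kj jt]] := theta1_NI jJ jI.
rewrite /theta1 (negPf jI); case: eqP => _; first exact: ltn_trans ti.
have [lt|ge] := ltnP j k; first exact: ltn_trans kj.
have {}ge : (k < j)%N by rewrite ltn_neqAle ge andbT eq_sym.
move: jI; rewrite mem_Iset // ge /= (negPf njk) /= -leqNgt; exact: leq_trans.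
Qed.
End Theta1.

(** The quantification over [eps] covers both evaluation at a point of the orbit and substitution
    into S(n). *)
Lemma Qpol_type0 g : g \in Mset xi -> (jr g <= sigma (ir g))%N ->
  let k := ir g in let t := jr g in
  exists b : bool, forall (R : comNzRingType) (eps : {rmorphism Sut K n -> R}),
    eps (Qpol K sigma xi g) = (-1) ^+ b * \det (mask (Jset sigma k t)
      (\matrix_(i, j) map_mx eps (Phi K n) (theta0 k t i) j)).
Proof.
move=> gM t0 k t; have tk : (t < k)%N := jr_lt_ir g.
have disj := disjoint_JI tk.
have [||b bE] := @Pcoef_pencil K n sigma k t (theta0 k t) (@theta0_in k t) (@theta0_inj k t).
- by move=> j; rewrite disj in_set0.
- by move=> j; rewrite in_setD => /andP[_]; apply: theta0_gt.
exists b => R eps; rewrite /Qpol (type0E sigmaK xiP) t0 (Qpol_index xiP) t0 bE.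
rewrite rmorphM rmorph_sign coef_det_pencil_map det_pencil_coef0 disj.
congr (_ * \det _); apply/matrixP=> i j; rewrite !maskE; case: ifP => // _.
by rewrite !mxE in_set0.
Qed.

Lemma Qpol_type1 g : g \in Mset xi -> (sigma (ir g) < jr g)%N ->
  let k := sigma (ir g) in let t := jr g in
  let J := Jset sigma k t in let I := Iset sigma k t in
  [/\ (sigma t < k)%N, (k < t)%N, (t < sigma k)%N &
  exists b : bool, forall (R : comNzRingType) (eps : {rmorphism Sut K n -> R}),
    eps (Qpol K sigma xi g) = (-1) ^+ b *
      (\det (pencil J (J :&: I) (theta1 k t) (map_mx eps (Phi K n))))`_1].
Proof.
move=> gM t1 k t J I; have ti : (t < sigma k)%N by rewrite sigmaK; apply: jr_lt_ir.
have sk : (sigma t < k)%N.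
  by move: gM; rewrite (MsetE xiP) (ltnW t1).
have kt : (k < t)%N by [].
split=> //.
have [b bE] := @Pcoef_pencil K n sigma k t (theta1 k t) (theta1_in sk kt ti)
  (theta1_inj sk kt ti) (@theta1_id k t) (theta1_gt sk kt ti).
exists b => R eps; rewrite /Qpol (type0E sigmaK xiP) (Qpol_index xiP).
by rewrite [(jr g <= _)%N]leqNgt t1 bE rmorphM rmorph_sign coef_det_pencil_map.
Qed.

(** The sign is chosen before [eps]: in D_m - D_m(f) the values under two different morphisms are
    compared, and their signs must agree. *)
Lemma Dmin_mask (k t : 'I_n) : (t < k)%N -> sigma t = k ->
  exists b : bool, forall (R : comNzRingType) (eps : {rmorphism Sut K n -> R}),
    eps (Dmin K sigma k t) = (-1) ^+ b * \det (mask (Jset sigma k t)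
      (\matrix_(i, j) map_mx eps (Phi K n) (sigma i) j)).
Proof.
move=> tk stk; have [||b bE] := @minor_mask (Sut K n) n _ _ (card_IJ sigma k t) sigma.
- move=> j; rewrite mem_Jset mem_Iset // sigmaK => /predU1P[->|/andP[-> ->]]; last by rewrite orbT.
  by rewrite stk eqxx.
- by move=> i j _ _; apply: perm_inj.
exists b => R eps; rewrite /Dmin bE rmorphM rmorph_sign -det_map_mx.
congr (_ * \det _); apply/matrixP=> i j; rewrite [LHS]mxE !maskE.
by case: ifP => _; rewrite ?rmorph_nat // !mxE.
Qed.
End Generators.

Section OrbitValues.
Variables (K : fieldType) (n : nat) (sigma : 'S_n) (xi : seq (posroot n)).
Hypothesis sigmaK : involutive sigma.
Hypothesis xiP : refl_decomp sigma xi.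
Variables (R : comUnitRingType) (c : 'I_n -> R) (u v : 'M[R]_n).
Hypothesis c_unit : forall j : 'I_n, (j < sigma j)%N -> c j \is a GRing.unit.
Hypothesis uU : upper_unitri u.
Hypothesis vU : upper_unitri v.
Hypothesis vu : v *m u = 1%:M.
Variable eps : {rmorphism Sut K n -> R}.
Hypothesis epsE : map_mx eps (Phi K n) = lower_part (u *m involution_mx sigma c *m v).

Lemma Mset_type0 g : g \in Mset xi -> (jr g <= sigma (ir g))%N ->
  (jr g < sigma (ir g))%N /\ (sigma (jr g) < ir g)%N.
Proof.
rewrite (MsetE xiP) => gM le; have lt := jr_lt_ir g; have e := sigma_val sigmaK (x := ir g) (y := jr g).
by move: gM; case: ifP; lia.
Qed.

Lemma Qpol_orbit g : g \in Mset xi -> eps (Qpol K sigma xi g) = 0.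
Proof.
move=> gM; have [le|lt] := leqP (jr g) (sigma (ir g)).
  have [b ->] := Qpol_type0 K sigmaK xiP gM le; have [_ st] := Mset_type0 gM le.
  rewrite epsE (orbit_type0_minor0 sigmaK c_unit vU vu (@theta0_in _ _ sigmaK _ _)
    (@theta0_inj _ _ _ _) (jr_lt_ir g) le st); exact: mulr0.
have [sk kt ti [b ->]] := Qpol_type1 K sigmaK xiP gM lt.
rewrite epsE (orbit_type1_coef1 sigmaK c_unit vU vu (theta1_in sigmaK sk kt ti)
  (theta1_inj sigmaK sk kt ti) sk kt ti); first exact: mulr0.
exact: theta1_id.
Qed.
End OrbitValues.

(** * The two inclusions *)

Lemma det_mask_col_add (R : comNzRingType) n (J : {set 'I_n}) (t : 'I_n)
    (theta : 'I_n -> 'I_n) (A B : 'M[R]_n) (delta : 'I_n -> R) :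
    t \in J -> (forall i, A i t = B i t + delta i) ->
    (forall i j, j \in J -> j != t -> A i j = B i j) ->
  \det (mask J (\matrix_(i, j) A (theta i) j)) =
  \det (mask J (\matrix_(i, j) B (theta i) j)) +
  \det (mask J (\matrix_(i, j) if j == t then delta (theta i) else B (theta i) j)).
Proof.
move=> tJ At AB.
apply: (@det_col_add _ _ _ _ _ t) => [i|i j ne|i j ne]; rewrite !maskE.
- rewrite tJ andbT; case: ifP => [_|iJ]; first by rewrite !mxE eqxx At.
  by case: eqP iJ => [->|_ _]; rewrite ?tJ ?addr0.
- by case: ifP => // /andP[_ jJ]; rewrite !mxE AB.
by case: ifP => // /andP[_ jJ]; rewrite !mxE (negPf ne) AB.
Qed.

Lemma lower_part_involution_mx (R : nzRingType) n (sigma : 'S_n) (c : 'I_n -> R) :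
  lower_part (1%:M *m involution_mx sigma c *m 1%:M) = involution_mx sigma c.
Proof.
by rewrite mul1mx mulmx1; apply/matrixP=> i j; rewrite !mxE; case: ifP => // ->.
Qed.

Section MainTheorem.
Variables (K : fieldType) (n : nat) (sigma : 'S_n) (xi : seq (posroot n)).
Variable f : ut_dual K n.
Hypothesis sigmaK : involutive sigma.
Hypothesis xiP : refl_decomp sigma xi.
Hypothesis fX : Xsigma xi f.
Let c (j : 'I_n) : K := dual_mx f (sigma j) j.

Lemma c_unit (j : 'I_n) : (j < sigma j)%N -> c j \is a GRing.unit.
Proof. exact: (dual_mx_Xsigma xiP fX).2. Qed.

Lemma dual_mx_f : dual_mx f = involution_mx sigma c.
Proof. exact: (dual_mx_Xsigma xiP fX).1. Qed.

Lemma xi_arc x : x \in xi -> sigma (jr x) = ir x.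
Proof. by rewrite (refl_decomp_mem xiP) => /eqP. Qed.

Lemma Dmin_arc x : x \in xi -> exists b : bool,
  (forall (R : comNzRingType) (eps : {rmorphism Sut K n -> R}),
    eps (Dmin K sigma (ir x) (jr x)) = (-1) ^+ b * \det (mask (Jset sigma (ir x) (jr x))
      (\matrix_(i, j) map_mx eps (Phi K n) (sigma i) j))) /\
  evalS (Dmin K sigma (ir x) (jr x)) f =
    (-1) ^+ b * \prod_(j in Jset sigma (ir x) (jr x)) c j.
Proof.
move=> xxi; have sx := xi_arc xxi; have lt := jr_lt_ir x.
have [b bE] := Dmin_mask K sigmaK lt sx; exists b; split=> //.
rewrite /evalS -[LHS]/(meval _ _) bE -/(dual_mx f) dual_mx_f.
rewrite -(lower_part_involution_mx sigma c) (orbit_arc_minor c) //.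
- exact: upper_unitri1.
- exact: upper_unitri1.
Qed.

Lemma coorbit_vanishing (p : Sut K n) :
  generated_ideal (orbit_gens sigma xi f) p -> vanishing_ideal (coorbit f) p.
Proof.
case=> s sG -> h [g UTg ->].
pose e : {rmorphism Sut K n -> K} := meval (fun a => coAd g f (ybase K (enum_val a))).
rewrite -[LHS]/(e _) rmorph_sum big1_seq // => -[q1 q] /sG /= Gq.
pose u := (invmx g)^T; pose v := g^T.
have uU : upper_unitri u by apply/UT_upper_unitri/UT_inv.
have vU : upper_unitri v by apply: UT_upper_unitri.
have vu : v *m u = 1%:M by rewrite -trmx_mul mulVmx ?trmx1 // UT_unit.
have epsE : dual_mx (coAd g f) = lower_part (u *m involution_mx sigma c *m v).
  by rewrite dual_mx_coAd // dual_mx_f.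
rewrite rmorphM; suff -> : e q = 0 by rewrite mulr0.
case: Gq => [[r rM ->]|[x xxi ->]].
  exact: (Qpol_orbit sigmaK xiP c_unit vU vu epsE rM).
have [b [bE ->]] := Dmin_arc xxi.
rewrite rmorphB /= [X in _ - X]mevalC bE; set M := map_mx _ _.
have -> : M = lower_part (u *m involution_mx sigma c *m v) by exact: epsE.
rewrite (orbit_arc_minor c uU vU (jr_lt_ir x) (xi_arc xxi)).
exact: subrr.
Qed.

Let I := generated_ideal (orbit_gens sigma xi f).

(** * Congruence of [Phi] with the generic orbit point *)

Section GenericOrbitPoint.
Let cS (j : 'I_n) : Sut K n := (c j)%:MP.
Variables u v : 'M[Sut K n]_n.
Hypothesis uU : upper_unitri u.
Hypothesis vU : upper_unitri v.
Hypothesis vu : v *m u = 1%:M.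
Let psi := lower_part (u *m involution_mx sigma cS *m v).
Hypothesis psi_free : forall t i : 'I_n, (t < i)%N -> ~~ constrained sigma t i ->
  psi i t = Phi K n i t.

Lemma cS_unit (j : 'I_n) : (j < sigma j)%N -> cS j \is a GRing.unit.
Proof. by move=> lt; rewrite /cS rmorph_unit // c_unit. Qed.

Lemma comp_subst_cong (A : 'M[Sut K n]_n) (q : Sut K n) :
    (forall i j : 'I_n, (j < i)%N -> I (Phi K n i j - A i j)) ->
  I (q - (q \mPo subst_mx A)).
Proof.
move=> IA; rewrite -{1}[q]comp_mpoly_id; apply: comp_mpoly_cong => a.
rewrite !tnth_mktuple; have := IA _ _ (jr_lt_ir (enum_val a)).
by rewrite Phi_gt /yvar enum_valK.
Qed.

Lemma psi_le (i j : 'I_n) : (i <= j)%N -> psi i j = 0.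
Proof. by move=> le; rewrite mxE ltnNge le. Qed.

Lemma ord_desc_ind (P : 'I_n -> Prop) :
  (forall e : 'I_n, (forall p : 'I_n, (e < p)%N -> P p) -> P e) -> forall e, P e.
Proof.
move=> IH e; have [m le] := ubnP (n - e); elim: m e le => // m IHm e le.
by apply: IH => p lt; apply: IHm; have := ltn_ord p; lia.
Qed.

Section Column.
Variable t : 'I_n.
Hypothesis colIH : forall i j : 'I_n, (j < t)%N -> I (Phi K n i j - psi i j).
Let delta (x : 'I_n) : Sut K n := if (t < x)%N then Phi K n x t - psi x t else 0.
Let delta' (e : 'I_n) : Sut K n := \sum_x v e x * delta x.
(** By the hypothesis on earlier columns, substituting [A] for [Phi] preserves the ideal; and a
    minor for [(k, t)] taken at [A] differs from the one at [psi] only through [delta] in column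
    [t]. *)
Let A : 'M[Sut K n]_n := \matrix_(i, j) if (j < t)%N then psi i j else Phi K n i j.

Lemma A_lower : lower_part A = A.
Proof.
apply/matrixP=> i j; rewrite mxE; case: ltnP => // le.
by rewrite mxE; case: ifP => _; rewrite ?psi_le ?Phi_le.
Qed.

Lemma A_lt (i j : 'I_n) : (j < t)%N -> A i j = psi i j.
Proof. by move=> lt; rewrite mxE lt. Qed.

Lemma A_t i : A i t = psi i t + delta i.
Proof.
rewrite mxE ltnn /delta; case: ltnP => [_|le]; first by rewrite addrC subrK.
by rewrite Phi_le // psi_le // addr0.
Qed.

Lemma comp_A_ideal q : I q -> I (q \mPo subst_mx A).
Proof.
move=> Iq; have : I (q - (q \mPo subst_mx A)).
  apply: comp_subst_cong => i j _; rewrite [A i j]mxE; case: ifP => [lt|_].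
    exact: colIH.
  by rewrite subrr; apply: generated_ideal0.
by move/(generated_idealB Iq); rewrite opprB addrC subrK.
Qed.

Lemma sum_cv_delta (w : 'rV[Sut K n]_n) :
  \sum_x (w *m v) 0 x * delta x = \sum_p w 0 p * delta' p.
Proof.
under eq_bigr => x _ do rewrite mxE mulr_suml.
rewrite exchange_big /=; apply: eq_bigr => p _; rewrite mulr_sumr.
by apply: eq_bigr => x _; rewrite mulrA.
Qed.

Lemma ideal_sign (b : bool) q : I ((-1) ^+ b * q) -> I q.
Proof.
by move/(generated_idealMl ((-1) ^+ b)); rewrite mulrA -signr_addb addbb mul1r.
Qed.

Lemma det_mask_A (k : 'I_n) (theta : 'I_n -> 'I_n) :
  \det (mask (Jset sigma k t) (\matrix_(i, j) A (theta i) j)) =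
  \det (mask (Jset sigma k t) (\matrix_(i, j) psi (theta i) j)) +
  \det (mask (Jset sigma k t)
    (\matrix_(i, j) if j == t then delta (theta i) else psi (theta i) j)).
Proof.
apply: det_mask_col_add => [|i|i j]; [by rewrite mem_Jset eqxx|exact: A_t|].
by rewrite mem_Jset => /predU1P[->|/andP[lt _] _]; [rewrite eqxx|apply: A_lt].
Qed.

(** Descending induction on [e]: the linear form has coefficient 1 at [e], and its other terms are
    at later indices satisfying the same hypotheses. *)
Lemma delta'_type0 (e : 'I_n) : (t < e)%N -> (t <= sigma e)%N -> (sigma t <= e)%N ->
  I (delta' e).
Proof.
elim/ord_desc_ind: e => k IHk tk sk st.
(* The two branches agree on [Jset]; the choice matches [Dmin_mask] for an arc and [Qpol_type0]
   otherwise, so both cases share one linear form. *)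
pose theta := if k == sigma t then sigma : 'I_n -> 'I_n else theta0 sigma k t.
have thE : {in Jset sigma k t, theta =1 theta0 sigma k t}.
  by move=> j _; rewrite /theta /theta0; case: eqP => // ->; case: eqP => [->|].
have thI : {in Jset sigma k t, forall j, theta j \in Iset sigma k t}.
  by move=> j jJ; rewrite thE // theta0_in.
have th_inj : {in Jset sigma k t &, injective theta}.
  by move=> i j iJ jJ; rewrite !thE //; apply: theta0_inj.
have [w [e [w0 wk wE]]] := orbit_type0_dvd sigmaK cS_unit vU vu thI th_inj delta tk sk st.
have ID : I (\det (mask (Jset sigma k t)
    (\matrix_(i, j) if j == t then delta (theta i) else psi (theta i) j))).
  have [g [ej ei]] := posrootW tk.
  have [ek|nk] := eqVneq k (sigma t).
    have gxi : g \in xi by rewrite (refl_decomp_mem xiP) ei ej ek.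
    have [b [bE fE]] := Dmin_arc gxi.
    have : I (Dmin K sigma (ir g) (jr g) - (evalS (Dmin K sigma (ir g) (jr g)) f)%:MP).
      by apply: generated_ideal_gen; right; exists g.
    move/comp_A_ideal; rewrite comp_mpolyB comp_mpolyC fE.
    rewrite [X in I (X - _)](bE _ (comp_mpoly (subst_mx A))) map_subst_Phi A_lower ei ej.
    have -> : (\matrix_(i, j) A (sigma i) j) = (\matrix_(i, j) A (theta i) j).
      by apply/matrixP=> i j; rewrite !mxE /theta ek eqxx.
    rewrite det_mask_A.
    have -> : \matrix_(i, j) psi (theta i) j = \matrix_(i, j) psi (sigma i) j.
      by apply/matrixP=> i j; rewrite !mxE /theta ek eqxx.
    (* The minor at [psi] is the product of the constants attached to the arcs, which is D_m(f) up
       to the common sign; the two cancel and the part linear in [delta] remains. *)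
    rewrite (orbit_arc_minor cS) // rmorphM rmorph_sign rmorph_prod /=.
    by rewrite mulrDr addrAC subrr add0r; apply: ideal_sign.
  have gM : g \in Mset xi.
    rewrite (MsetE xiP) ei ej; have h := sigma_val sigmaK (x := k) (y := t).
    have {}nk : (k : nat) <> sigma t by move=> /val_inj h'; rewrite h' eqxx in nk.
    by case: ifP; lia.
  have sk' : (jr g <= sigma (ir g))%N by rewrite ej ei.
  have [b bE] := Qpol_type0 K sigmaK xiP gM sk'.
  have thE0 : theta = theta0 sigma k t by rewrite /theta (negPf nk).
  have : I (Qpol K sigma xi g) by apply: generated_ideal_gen; left; exists g.
  move/comp_A_ideal; rewrite [X in I X](bE _ (comp_mpoly (subst_mx A))).
  rewrite map_subst_Phi A_lower ei ej -thE0 det_mask_A.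
  have st' : (sigma t < k)%N.
    by rewrite ltn_neqAle st andbT; apply: contra_neq nk => /val_inj.
  rewrite (orbit_type0_minor0 sigmaK cS_unit vU vu thI th_inj tk sk st') add0r.
  exact: ideal_sign.
rewrite sum_cv_delta (bigD1 k) //= wk mul1r in wE.
have -> : delta' k = e * \det (mask (Jset sigma k t)
    (\matrix_(i, j) if j == t then delta (theta i) else psi (theta i) j)) -
    \sum_(p < n | p != k) w 0 p * delta' p by rewrite -wE addrK.
apply: generated_idealB; first exact: generated_idealMl.
apply: generated_ideal_sum => p np; case: (boolP ((k <= p)%N && (t <= sigma p)%N)).
  case/andP=> kp tp; apply: generated_idealMl; apply: IHk => //.
  - by rewrite ltn_neqAle eq_sym np.
  - exact: leq_trans kp.
  - exact: leq_trans kp.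
by move/w0 ->; rewrite mul0r; apply: generated_ideal0.
Qed.

(** The induction descends on [k], not on the row [sigma k]: besides [sigma k], whose coefficient is
    the inverse of [cS k], the form meets only indices settled by [delta'_type0] and indices [p]
    with [k < sigma p < t]. *)
Lemma delta'_type1 (k : 'I_n) : (sigma t < k)%N -> (k < t)%N -> (t < sigma k)%N ->
  I (delta' (sigma k)).
Proof.
elim/ord_desc_ind: k => k IHk sk kt ti.
have d0 (x : 'I_n) : (x <= t)%N -> delta x = 0 by rewrite /delta; case: ltnP.
have [w [e [w0 wk wE]]] := orbit_type1_dvd sigmaK cS_unit vU vu (theta1_in sigmaK sk kt ti)
  (theta1_inj sigmaK sk kt ti) sk kt ti (@theta1_id _ _ _ _) d0
  (fun x j lt => A_lt x lt) A_t.
have ID : I (\det (pencil (Jset sigma k t) (Jset sigma k t :&: Iset sigma k t)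
    (theta1 sigma k t) A))`_1.
  have [g [ej ei]] := posrootW ti; have sk' : sigma (ir g) = k by rewrite ei sigmaK.
  have gM : g \in Mset xi by rewrite (MsetE xiP) sk' ej (ltnW kt).
  have lt : (sigma (ir g) < jr g)%N by rewrite sk' ej.
  have [_ _ _ [b bE]] := Qpol_type1 K sigmaK xiP gM lt.
  have : I (Qpol K sigma xi g) by apply: generated_ideal_gen; left; exists g.
  move/comp_A_ideal; rewrite [X in I X](bE _ (comp_mpoly (subst_mx A))).
  rewrite map_subst_Phi A_lower sk' ej; exact: ideal_sign.
rewrite sum_cv_delta (bigD1 (sigma k)) //= in wE.
have -> : delta' (sigma k) = cS k * (w 0 (sigma k) * delta' (sigma k)).
  by rewrite mulrA [cS k * _]mulrC wk mul1r.
apply: generated_idealMl.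
set S := \sum_(p < n | _) _ in wE.
have -> : w 0 (sigma k) * delta' (sigma k) = (w 0 (sigma k) * delta' (sigma k) + S) - S.
  by rewrite addrK.
rewrite wE; apply: generated_idealB; first exact: generated_idealMl.
apply: generated_ideal_sum => p np.
case: (boolP ((t < p)%N && ((t < sigma p)%N || (k <= sigma p < t)%N))) => [|/w0 ->]; last first.
  by rewrite mul0r; apply: generated_ideal0.
case/andP=> tp; case/orP=> [tsp|/andP[ksp spt]]; apply: generated_idealMl.
  by apply: delta'_type0 => //; rewrite ltnW // (ltn_trans sk) // (ltn_trans kt).
rewrite -[p]sigmaK; apply: IHk; rewrite ?sigmaK //; last exact: leq_trans ksp.
rewrite ltn_neqAle ksp andbT; apply: contra_neq np => /val_inj ->.
by rewrite sigmaK.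
Qed.

(** As [v] is unitriangular, [delta e] differs from [delta' e] by a combination of later entries of
    [delta]. At unconstrained positions [delta] is zero by the choice of [psi], so [delta' e] is
    needed only at constrained ones. *)
Lemma column_cong i : I (Phi K n i t - psi i t).
Proof.
suff Id x : I (delta x).
  have := Id i; rewrite /delta; case: ltnP => // le _.
  by rewrite Phi_le // psi_le // subrr; apply: generated_ideal0.
elim/ord_desc_ind: x => e IHe.
rewrite /delta; case: ltnP => [te|_]; last exact: generated_ideal0.
have [ce|/(psi_free te) ->] := boolP (constrained sigma t e); last first.
  by rewrite subrr; apply: generated_ideal0.
have Id' : I (delta' e).
  have h := sigma_val sigmaK (x := e) (y := t).
  have [lt|ge] := ltnP (sigma e) t.
    have st : (sigma t < sigma e)%N.
      move: ce; rewrite /constrained (ltnW lt) => /orP[/eqP es|//].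
      by move: lt; rewrite es sigmaK ltnn.
    by rewrite -[e]sigmaK; apply: delta'_type1; rewrite ?sigmaK.
  apply: delta'_type0 => //; move: ce; rewrite /constrained => /orP[/eqP <-//|].
  by case: ifP; lia.
have -> : Phi K n e t - psi e t = delta' e - \sum_(x < n | (e < x)%N) v e x * delta x.
  rewrite /delta' (bigD1 e) //= vU // eqxx mul1r {1}/delta te [X in _ + X - _](bigID (fun x : 'I_n => (e < x)%N)) /=.
  rewrite [X in _ + (_ + X) - _]big1 ?addr0; last first.
    move=> x /andP[ne]; rewrite -leqNgt => le; rewrite vU //.
    by rewrite eq_sym (negPf ne) mul0r.
  rewrite [X in _ + X - _](eq_bigl (fun x : 'I_n => (e < x)%N)) ?addrK // => x.
  by rewrite andbC; case: ltnP => // lt; apply: contraTneq lt => ->; rewrite ltnn.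
apply: generated_idealB => //; apply: generated_ideal_sum => x lt.
exact/generated_idealMl/IHe.
Qed.
End Column.

Lemma Phi_psi_cong i j : I (Phi K n i j - psi i j).
Proof.
have [m le] := ubnP j; elim: m i j le => // m IHm i j le.
by apply: column_cong => a b lt; apply: IHm; apply: leq_trans lt _.
Qed.
End GenericOrbitPoint.

Lemma vanishing_coorbit (charK : [pchar K] =i pred0) (p : Sut K n) :
  vanishing_ideal (coorbit f) p -> I p.
Proof.
move=> pv; pose cS (j : 'I_n) : Sut K n := (c j)%:MP.
have [u [v [[uU vU] [uv vu] uvE]]] :=
  @free_coords_surj _ n sigma cS sigmaK cS_unit (Phi K n).
pose psi := lower_part (u *m involution_mx sigma cS *m v).
have psi_free (t i : 'I_n) : (t < i)%N -> ~~ constrained sigma t i -> psi i t = Phi K n i t.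
  by move=> lt nc; rewrite /psi lower_partE // uvE.
have : I (p - (p \mPo subst_mx psi)).
  by apply: comp_subst_cong => i j _; apply: Phi_psi_cong vU vu psi_free i j.
suff -> : p \mPo subst_mx psi = 0 by rewrite subr0.
apply: (mpoly_meval_eq0 charK) => x; rewrite comp_mpoly_meval.
pose ev : {rmorphism Sut K n -> K} := meval x.
(* At every point [x] the matrices [u] and [v] specialise to [K], and [psi] becomes the matrix of
   the translate of [f] by this [g], a point of the orbit. *)
pose g := (map_mx ev v)^T.
have UTg : UT g.
  by apply: upper_unitri_UT => i j le; rewrite mxE vU // rmorph_nat.
have gV : invmx g = (map_mx ev u)^T.
  apply: (can_inj (mulKmx (UT_unit UTg))); rewrite mulmxV ?UT_unit // /g.
  by rewrite -trmx_mul -map_mxM uv map_mx1 trmx1.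
rewrite -(pv (coAd g f)); last by exists g.
rewrite /evalS; apply: meval_eq => a; rewrite tnth_mktuple -dual_mx_gt dual_mx_coAd //.
rewrite gV /g !trmxK dual_mx_f -[LHS]/(ev _) /psi !lower_partE ?jr_lt_ir //.
have -> : involution_mx sigma c = map_mx ev (involution_mx sigma cS).
  apply/matrixP=> i j; rewrite !mxE; case: ifP => _; last by rewrite rmorph0.
  by rewrite /ev /= mevalC.
by rewrite -!map_mxM [RHS]mxE.
Qed.
End MainTheorem.

Theorem theorem1p4 (K : fieldType) (charK : [pchar K]%R =i pred0) (n : nat)
    (sigma : 'S_n) (sigma2 : (sigma * sigma)%g = 1%g)
    (xi : seq (posroot n)) (xiP : refl_decomp sigma xi)
    (f : ut_dual K n) (fX : Xsigma xi f) (p : Sut K n) :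
  vanishing_ideal (coorbit f) p <->
  generated_ideal (orbit_gens sigma xi f) p.
Proof.
have sigmaK : involutive sigma by move=> a; rewrite -permM sigma2 perm1.
split; first exact: vanishing_coorbit.
exact: coorbit_vanishing.
Qed.
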